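(* Let $\mathcal K$ be a field with $\operatorname{char}\mathcal K=p>0$ and let $q=1\in\mathcal K$. Let $\lambda,\mu\in X$ and suppose that $\mu\le\lambda$. Suppose that $r\ge0$ is an integer such that $p^r$ is strictly bigger than any coefficient in the expansion of $\lambda-\mu$ in terms of simple roots. Then $$\dim_{\mathcal K} L_{\mathcal K}(\lambda)_\mu=\dim_{\mathcal K} L_{\mathcal K}(\lambda+p^r\gamma)_{\mu+p^r\gamma}$$ for all $\gamma\in X$.
   Context: Let $R$ be a root system with basis (set of simple roots) $\Pi$, coroots $\alpha^\vee$, and weight lattice $X$; write $\langle\mu,\alpha^\vee\rangle\in\mathbb Z$ for the pairing. For $\mu,\lambda\in X$ write $\mu\le\lambda$ if $\lambda-\mu$ is a sum of simple roots with coefficients in $\mathbb Z_{\ge0}$. For $\alpha,\beta\in\Pi$ put $a_{\alpha\beta}=\langle\beta,\alpha^\vee\rangle$, and let $d_\alpha\in\{1,2,3\}$ ($\alpha\in\Pi$) be such that $(d_\alpha a_{\alpha\beta})$ is symmetric and each irreducible component of $R$ contains a simple root $\alpha$ with $d_\alpha=1$. Let $\mathcal Z=\mathbb Z[v,v^{-1}]$, $\mathcal Q=\mathbb Q(v)$. Put $[n]=\frac{v^n-v^{-n}}{v-v^{-1}}$ for $n\in\mathbb Z$, $[n]^!=[1][2]\cdots[n]$ for $n\ge0$, and $\left[{n\atop r}\right]=\frac{[n][n-1]\cdots[n-r+1]}{[1]\cdots[r]}$ for $n\in\mathbb Z$, $r\ge0$; these lie in $\mathcal Z$. Put $v_\alpha=v^{d_\alpha}$;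 a subscript $\alpha$ on these symbols means that $v$ is replaced by $v_\alpha$. The quantum group $U_{\mathcal Q}$ is the associative unital $\mathcal Q$-algebra with generators $e_\alpha,f_\alpha,k_\alpha,k_\alpha^{-1}$ ($\alpha\in\Pi$) and relations $k_\alpha k_\beta=k_\beta k_\alpha$, $k_\alpha k_\alpha^{-1}=1=k_\alpha^{-1}k_\alpha$, $k_\alpha e_\beta=v_\alpha^{a_{\alpha\beta}}e_\beta k_\alpha$, $k_\alpha f_\beta=v_\alpha^{-a_{\alpha\beta}}f_\beta k_\alpha$, $[e_\alpha,f_\beta]=0$ for $\alpha\ne\beta$, $[e_\alpha,f_\alpha]=\frac{k_\alpha-k_\alpha^{-1}}{v_\alpha-v_\alpha^{-1}}$, and for $\alpha\neq\beta$ the Serre relations $\sum_{r+s=1-a_{\alpha\beta}}(-1)^s\left[{1-a_{\alpha\beta}\atop s}\right]_\alpha e_\alpha^r e_\beta e_\alpha^s=0$ and the same with $f$ in place of $e$. Put $e_\alpha^{[n]}=e_\alpha^n/[n]_\alpha^!$, $f_\alpha^{[n]}=f_\alpha^n/[n]^!_\alpha$, $\left[{k_\alpha\atop n}\right]_\alpha=\prod_{s=1}^n\frac{k_\alpha v_\alpha^{-s+1}-k_\alpha^{-1}v_\alpha^{s-1}}{v_\alpha^s-v_\alpha^{-s}}$. Let $U_{\mathcal Z}\subset U_{\mathcal Q}$ be the $\mathcal Z$-subalgebra generated by all $e_\alpha^{[n]},f_\alpha^{[n]},k_\alpha^{\pm1}$ ($\alpha\in\Pi,n\ge0$), and let $U_{\mathcal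 Z}^+,U_{\mathcal Z}^-,U_{\mathcal Z}^0$ be the $\mathcal Z$-subalgebras generated by the $e_\alpha^{[n]}$, by the $f_\alpha^{[n]}$, and by the $k_\alpha^{\pm1},\left[{k_\alpha\atop n}\right]_\alpha$, respectively. Given a field $\mathcal K$ and an invertible $q\in\mathcal K$, view $\mathcal K$ as a $\mathcal Z$-algebra via $v\mapsto q$, and set $U_{\mathcal K}=U_{\mathcal Z}\otimes_{\mathcal Z}\mathcal K$, and likewise $U^{\pm}_{\mathcal K},U^0_{\mathcal K}$. Multiplication gives an isomorphism $U^-_{\mathcal K}\otimes U^0_{\mathcal K}\otimes U^+_{\mathcal K}\to U_{\mathcal K}$. Each $\mu\in X$ gives a character $U^0_{\mathcal Z}\to\mathcal Z$, $k_\alpha^{\pm1}\mapsto v_\alpha^{\pm\langle\mu,\alpha^\vee\rangle}$, $\left[{k_\alpha\atop r}\right]_\alpha\mapsto\left[{\langle\mu,\alpha^\vee\rangle\atop r}\right]_\alpha$, and by base change a character $\mu\colon U^0_{\mathcal K}\to\mathcal K$. For a $U_{\mathcal K}$-module $M$ put $M_\mu=\{m\in M\mid Hm=\mu(H)m\ \forall H\in U^0_{\mathcal K}\}$. For $\lambda\in X$ the Verma module is $\Delta_{\mathcal K}(\lambda)=U_{\mathcal K}\otimes_{U_{\mathcal K}^0U_{\mathcal K}^+}\mathcal K_\lambda$, where $\mathcal K_\lambda=\mathcal K$ with $U^0_{\mathcal K}$ acting via $\lambda$ and $e_\alpha^{[n]}$ acting by $0$ for $n>0$. $L_{\mathcal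 K}(\lambda)$ denotes its unique irreducible quotient; it is the direct sum of its weight spaces $L_{\mathcal K}(\lambda)_\mu$, $\mu\in X$. *)

(* Defs.v *)
From HB Require Import structures.
From mathcomp Require Import all_boot all_order all_algebra.
From mathcomp Require Import boolp.
From mathcomp Require Import finmap monalg.

Set Implicit Arguments.
Unset Strict Implicit.
Unset Printing Implicit Defensive.

Import Order.TTheory GRing.Theory Num.Theory.
Local Open Scope ring_scope.
Local Open Scope quotient_scope.

(* ------------------------------------------------------------------ *)
(* M ⊗_B N as formal sums of pairs modulo the least additive congruence making
   pairs biadditive and B-balanced.  B is a bare type acting on the right of M
   through [ract] and on the left of N through [lact]. *)
Section Tensor.
Variables (B : Type) (M N : zmodType) (ract : M -> B -> M) (lact : B -> N -> N).

Inductive tensor_eq : seq (M * N) -> seq (M * N) -> Prop :=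
| teq_refl s : tensor_eq s s
| teq_sym s t : tensor_eq s t -> tensor_eq t s
| teq_trans s t u : tensor_eq s t -> tensor_eq t u -> tensor_eq s u
| teq_cat s s' t t' :
    tensor_eq s s' -> tensor_eq t t' -> tensor_eq (s ++ t) (s' ++ t')
| teq_catC s t : tensor_eq (s ++ t) (t ++ s)
| teq_zero n : tensor_eq [:: (0, n)] [::]
| teq_addl m m' n : tensor_eq [:: (m + m', n)] [:: (m, n); (m', n)]
| teq_addr m n n' : tensor_eq [:: (m, n + n')] [:: (m, n); (m, n')]
| teq_bal m b n : tensor_eq [:: (ract m b, n)] [:: (m, lact b n)].

Definition tensor_rel : rel (seq (M * N)) := fun s t => `[< tensor_eq s t >].

Fact tensor_rel_equiv : equiv_class_of tensor_rel.
Proof.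
split=> [s|s t|t s u].
- by apply/asboolP; apply: teq_refl.
- by apply/asboolP/asboolP; apply: teq_sym.
- by move=> /asboolP st /asboolP tu; apply/asboolP; apply: teq_trans tu.
Qed.
Canonical tensor_rel_canonical := EquivRelPack tensor_rel_equiv.
Canonical tensor_rel_encModRel := defaultEncModRel tensor_rel.

Definition tensor := {eq_quot tensor_rel}.
HB.instance Definition _ : EqQuotient _ tensor_rel tensor :=
  EqQuotient.on tensor.
HB.instance Definition _ := Choice.on tensor.

Definition tclass (s : seq (M * N)) : tensor := \pi_tensor s.

Lemma tclassP s t : tclass s = tclass t <-> tensor_eq s t.
Proof.
split=> [/eqP|st]; first by rewrite /tclass piE => /asboolP.
by apply/eqP; rewrite /tclass piE; apply/asboolP.
Qed.

Lemma tclassK x : tclass (repr x) = x. Proof. exact: reprK. Qed.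

Fact tens_key : unit. Proof. by []. Qed.
Definition tens_zero : tensor := tclass [::].
Definition tens_add : tensor -> tensor -> tensor :=
  locked_with tens_key (fun x y => tclass (repr x ++ repr y)).
Definition tens_opp : tensor -> tensor :=
  locked_with tens_key (fun x => tclass [seq (- p.1, p.2) | p <- repr x]).

Lemma tens_addE s t : tens_add (tclass s) (tclass t) = tclass (s ++ t).
Proof.
by rewrite /tens_add unlock; apply/tclassP/teq_cat; apply/tclassP; rewrite tclassK.
Qed.

Lemma tens_addA : associative tens_add.
Proof.
move=> x y z; rewrite -[x]tclassK -[y]tclassK -[z]tclassK !tens_addE.
by rewrite catA.
Qed.

Lemma tens_addC : commutative tens_add.
Proof.
move=> x y; rewrite -[x]tclassK -[y]tclassK !tens_addE.
exact/tclassP/teq_catC.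
Qed.

Lemma tens_add0 : left_id tens_zero tens_add.
Proof. by move=> x; rewrite -[x]tclassK tens_addE. Qed.

Lemma tens_addN : left_inverse tens_zero tens_opp tens_add.
Proof.
move=> x; rewrite -{2}[x]tclassK /tens_opp unlock tens_addE; apply/tclassP.
elim: (repr x) => [|[m n] s IH] /=; first exact: teq_refl.
rewrite -cat1s -[(m, n) :: s]cat1s.
apply: (@teq_trans _ ([:: (- m, n); (m, n)] ++
   ([seq (- p.1, p.2) | p <- s] ++ s))).
  rewrite -[[:: (-m, n); (m, n)]]/([:: (- m, n)] ++ [:: (m, n)]).
  rewrite -!catA; apply: teq_cat; first exact: teq_refl.
  rewrite !catA; apply: teq_cat; last exact: teq_refl.
  exact: teq_catC.
rewrite -[X in tensor_eq _ X]cat0s; apply: teq_cat => //.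
apply: teq_trans (teq_zero n).
by have := teq_sym (teq_addl (- m) m n); rewrite addNr.
Qed.

HB.instance Definition _ := GRing.isZmodule.Build tensor
  tens_addA tens_addC tens_add0 tens_addN.

Definition pure m n : tensor := tclass [:: (m, n)].

Lemma tclassD s t : tclass (s ++ t) = tclass s + tclass t.
Proof. by rewrite -tens_addE. Qed.

Lemma tclass_sum s : tclass s = \sum_(p <- s) pure p.1 p.2.
Proof.
elim: s => [|[m n] s IH]; first by rewrite big_nil.
by rewrite big_cons -cat1s tclassD IH.
Qed.

Lemma tensor_ind (P : tensor -> Prop) :
  P 0 -> (forall x y, P x -> P y -> P (x + y)) -> (forall m n, P (pure m n)) ->
  forall x, P x.
Proof.
move=> P0 PD Pp x; rewrite -[x]tclassK tclass_sum.
by elim/big_ind: _ => // p _; apply: Pp.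
Qed.

Lemma pureDl m m' n : pure (m + m') n = pure m n + pure m' n.
Proof. by rewrite -tclassD; apply/tclassP/teq_addl. Qed.

Lemma pureDr m n n' : pure m (n + n') = pure m n + pure m n'.
Proof. by rewrite -tclassD; apply/tclassP/teq_addr. Qed.

Lemma pure_bal m b n : pure (ract m b) n = pure m (lact b n).
Proof. exact/tclassP/teq_bal. Qed.

Section Lift.
Variables (W : zmodType) (f : M -> N -> W).
Hypothesis fDl : forall m m' n, f (m + m') n = f m n + f m' n.
Hypothesis fDr : forall m n n', f m (n + n') = f m n + f m n'.
Hypothesis f_bal : forall m b n, f (ract m b) n = f m (lact b n).

Definition tlift_seq (s : seq (M * N)) : W := \sum_(p <- s) f p.1 p.2.
Definition tlift (x : tensor) : W := tlift_seq (repr x).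

Lemma tlift_seqP s t : tensor_eq s t -> tlift_seq s = tlift_seq t.
Proof.
rewrite /tlift_seq; elim=> //.
- by move=> ??? _ -> _ ->.
- by move=> ???? _ IH1 _ IH2; rewrite !big_cat /= IH1 IH2.
- by move=> ??; rewrite !big_cat /= addrC.
- move=> n; rewrite big_seq1 big_nil /=.
  by apply: (addrI (f 0 n)); rewrite -fDl !addr0.
- by move=> m m' n; rewrite big_seq1 big_cons big_seq1 fDl.
- by move=> m n n'; rewrite big_seq1 big_cons big_seq1 fDr.
- by move=> m b n; rewrite !big_seq1 f_bal.
Qed.

Lemma tlift_class s : tlift (tclass s) = tlift_seq s.
Proof. by apply: tlift_seqP; apply/tclassP; rewrite tclassK. Qed.

Lemma tlift_pure m n : tlift (pure m n) = f m n.
Proof. by rewrite tlift_class /tlift_seq big_seq1. Qed.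

Lemma tliftD x y : tlift (x + y) = tlift x + tlift y.
Proof.
rewrite -[x]tclassK -[y]tclassK -tclassD !tlift_class /tlift_seq.
by rewrite big_cat.
Qed.

Lemma tlift0 : tlift 0 = 0.
Proof. by apply: (addrI (tlift 0)); rewrite -tliftD !addr0. Qed.
End Lift.

End Tensor.

(* ------------------------------------------------------------------ *)
Section BaseChange.
Variables (Z : comNzRingType) (A : algType Z) (k : fieldType).
Variable phi : {rmorphism Z -> k}.

Definition base_change : Type :=
  tensor (fun (a : A) (z : Z) => z *: a) (fun (z : Z) (c : k) => phi z * c).
HB.instance Definition _ := GRing.Zmodule.on base_change.

Definition bc (a : A) (c : k) : base_change := pure _ _ a c.

Lemma bc_ind (P : base_change -> Prop) :
  P 0 -> (forall x y, P x -> P y -> P (x + y)) -> (forall a c, P (bc a c)) ->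
  forall x, P x.
Proof. exact: tensor_ind. Qed.

Lemma bcDl a a' c : bc (a + a') c = bc a c + bc a' c.
Proof. exact: pureDl. Qed.
Lemma bcDr a c c' : bc a (c + c') = bc a c + bc a c'.
Proof. exact: pureDr. Qed.
Lemma bcZ z a c : bc (z *: a) c = bc a (phi z * c).
Proof. exact: pure_bal. Qed.

Definition bc_mull (a : A) (c : k) : base_change -> base_change :=
  tlift (fun a' c' => bc (a * a') (c * c')).

Lemma bc_mullE a c a' c' : bc_mull a c (bc a' c') = bc (a * a') (c * c').
Proof.
apply: tlift_pure => [m m' n|m n n'|m b n] /=.
- by rewrite mulrDr bcDl.
- by rewrite mulrDr bcDr.
- by rewrite -scalerAr bcZ mulrCA.
Qed.

Lemma bc_mullD a c x y : bc_mull a c (x + y) = bc_mull a c x + bc_mull a c y.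
Proof.
apply: tliftD => [m m' n|m n n'|m b n] /=.
- by rewrite mulrDr bcDl.
- by rewrite mulrDr bcDr.
- by rewrite -scalerAr bcZ mulrCA.
Qed.

Lemma bc_mull0 a c : bc_mull a c 0 = 0.
Proof. by apply: (addrI (bc_mull a c 0)); rewrite -bc_mullD !addr0. Qed.

Lemma bc_mull_Dl a a' c y : bc_mull (a + a') c y = bc_mull a c y + bc_mull a' c y.
Proof.
elim/bc_ind: y => [|y y' IH IH'|a1 c1]; first by rewrite !bc_mull0 addr0.
  by rewrite !bc_mullD IH IH' addrACA.
by rewrite !bc_mullE mulrDl bcDl.
Qed.

Lemma bc_mull_Dr a c c' y : bc_mull a (c + c') y = bc_mull a c y + bc_mull a c' y.
Proof.
elim/bc_ind: y => [|y y' IH IH'|a1 c1]; first by rewrite !bc_mull0 addr0.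
  by rewrite !bc_mullD IH IH' addrACA.
by rewrite !bc_mullE mulrDl bcDr.
Qed.

Lemma bc_mull_bal a z c y : bc_mull (z *: a) c y = bc_mull a (phi z * c) y.
Proof.
elim/bc_ind: y => [|y y' IH IH'|a1 c1]; first by rewrite !bc_mull0.
  by rewrite !bc_mullD IH IH'.
by rewrite !bc_mullE -scalerAl bcZ mulrA.
Qed.

End BaseChange.

HB.lock Definition bc_mul (Z : comNzRingType) (A : algType Z) (k : fieldType)
    (phi : {rmorphism Z -> k}) (x y : base_change A phi) : base_change A phi :=
  tlift (fun a c => bc_mull a c y) x.

Section BaseChangeRing.
Variables (Z : comNzRingType) (A : algType Z) (k : fieldType).
Variable phi : {rmorphism Z -> k}.
Local Notation base_change := (base_change A phi).
Local Notation bc := (@bc Z A k phi).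
Local Notation bc_mul := (@bc_mul Z A k phi).

Lemma bc_mulDl : left_distributive bc_mul +%R.
Proof.
move=> x x' y; rewrite bc_mul.unlock; apply: tliftD => *.
- exact: bc_mull_Dl.
- exact: bc_mull_Dr.
- exact: bc_mull_bal.
Qed.

Lemma bc_mul_bc a c y : bc_mul (bc a c) y = bc_mull a c y.
Proof.
rewrite bc_mul.unlock; apply: tlift_pure => *.
- exact: bc_mull_Dl.
- exact: bc_mull_Dr.
- exact: bc_mull_bal.
Qed.

Lemma bc_mulE a c a' c' : bc_mul (bc a c) (bc a' c') = bc (a * a') (c * c').
Proof. by rewrite bc_mul_bc bc_mullE. Qed.

Lemma bc_mul0l x : bc_mul 0 x = 0.
Proof. by apply: (addrI (bc_mul 0 x)); rewrite -bc_mulDl !addr0. Qed.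

Lemma bc_mulDr : right_distributive bc_mul +%R.
Proof.
move=> x y y'; elim/bc_ind: x => [|x x' IH IH'|a c].
- by rewrite !bc_mul0l addr0.
- by rewrite !bc_mulDl IH IH' addrACA.
- by rewrite !bc_mul_bc bc_mullD.
Qed.

Lemma bc_mul0r x : bc_mul x 0 = 0.
Proof. by apply: (addrI (bc_mul x 0)); rewrite -bc_mulDr !addr0. Qed.

Lemma bc_mulA : associative bc_mul.
Proof.
move=> x y z; elim/bc_ind: x => [|x x' IH IH'|a c].
- by rewrite !bc_mul0l.
- by rewrite !bc_mulDl IH IH'.
elim/bc_ind: y => [|y y' IH IH'|a' c'].
- by rewrite bc_mul0r !bc_mul0l bc_mul0r.
- by rewrite bc_mulDr !bc_mulDl bc_mulDr IH IH'.
elim/bc_ind: z => [|z z' IH IH'|a'' c'']; first by rewrite !bc_mul0r.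
  by rewrite !bc_mulDr IH IH'.
by rewrite !bc_mulE !mulrA.
Qed.

Lemma bc_mul1l : left_id (bc 1 1) bc_mul.
Proof.
elim/bc_ind => [|x x' IH IH'|a c]; first exact: bc_mul0r.
  by rewrite bc_mulDr IH IH'.
by rewrite bc_mulE !mul1r.
Qed.

Lemma bc_mul1r : right_id (bc 1 1) bc_mul.
Proof.
elim/bc_ind => [|x x' IH IH'|a c]; first exact: bc_mul0l.
  by rewrite bc_mulDl IH IH'.
by rewrite bc_mulE !mulr1.
Qed.

HB.instance Definition _ := GRing.Zmodule_isPzRing.Build base_change
  bc_mulA bc_mul1l bc_mul1r bc_mulDl bc_mulDr.

Lemma bcM a c a' c' : bc (a * a') (c * c') = bc a c * bc a' c'.
Proof. by rewrite -bc_mulE. Qed.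

Lemma bc1 : bc 1 1 = 1. Proof. by []. Qed.

End BaseChangeRing.

HB.lock Definition bc_scale (Z : comNzRingType) (A : algType Z) (k : fieldType)
    (phi : {rmorphism Z -> k}) (c : k) (x : base_change A phi) :
  base_change A phi := bc phi 1 c * x.

Section BaseChangeAlgebra.
Variables (Z : comNzRingType) (A : algType Z) (k : fieldType).
Variable phi : {rmorphism Z -> k}.
Local Notation base_change := (base_change A phi).
Local Notation bc := (@bc Z A k phi).
Local Notation bc_scale := (@bc_scale Z A k phi).
Local Notation bcM := (@bcM Z A k phi).

Lemma bc_scaleA c c' x : bc_scale c (bc_scale c' x) = bc_scale (c * c') x.
Proof. by rewrite bc_scale.unlock mulrA -bcM mulr1. Qed.
Lemma bc_scale1 : left_id 1 bc_scale.
Proof. by move=> x; rewrite bc_scale.unlock bc1 mul1r. Qed.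
Lemma bc_scaleDr : right_distributive bc_scale +%R.
Proof. by move=> c x y; rewrite bc_scale.unlock mulrDr. Qed.
Lemma bc_scaleDl x : {morph bc_scale^~ x : c c' / c + c'}.
Proof. by move=> c c'; rewrite bc_scale.unlock bcDr mulrDl. Qed.

HB.instance Definition _ := GRing.Zmodule_isLmodule.Build k base_change
  bc_scaleA bc_scale1 bc_scaleDr bc_scaleDl.

Lemma bc_scaleE c a c' : c *: bc a c' = bc a (c * c').
Proof. by rewrite /GRing.scale /= bc_scale.unlock -bcM mul1r. Qed.

Lemma bc_scaleAl c (x y : base_change) : c *: (x * y) = (c *: x) * y.
Proof. by rewrite /GRing.scale /= bc_scale.unlock mulrA. Qed.

Lemma bc_scaleAr c (x y : base_change) : c *: (x * y) = x * (c *: y).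
Proof.
rewrite /GRing.scale /= bc_scale.unlock !mulrA; congr (_ * y).
elim/bc_ind: x => [|x x' IH IH'|a c']; first by rewrite mulr0 mul0r.
  by rewrite mulrDr mulrDl IH IH'.
by rewrite -!bcM mul1r mulr1 mulrC.
Qed.

(* A ⊗_Z k is nontrivial as soon as A has an augmentation. *)
Lemma bc_neq0 (eps : A -> Z) : {morph eps : x y / x + y} ->
  (forall z a, eps (z *: a) = z * eps a) -> eps 1 = 1 ->
  1 != 0 :> base_change.
Proof.
move=> epsD epsZ eps1.
have ax1 m m' (n : k) : phi (eps (m + m')) * n = phi (eps m) * n + phi (eps m') * n.
  by rewrite epsD rmorphD mulrDl.
have ax2 m (n n' : k) : phi (eps m) * (n + n') = phi (eps m) * n + phi (eps m) * n'.
  by rewrite mulrDr.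
have ax3 m (b : Z) (n : k) : phi (eps (b *: m)) * n = phi (eps m) * (phi b * n).
  by rewrite epsZ rmorphM mulrA [phi b * _]mulrC.
apply/eqP => one0; have := tlift_pure ax1 ax2 ax3 1 1.
rewrite eps1 rmorph1 mulr1 => /eqP.
rewrite [pure _ _ _ _](_ : _ = 0); last exact: one0.
by rewrite (tlift0 ax1 ax2 ax3) eq_sym oner_eq0.
Qed.

End BaseChangeAlgebra.

(* ------------------------------------------------------------------ *)
Definition Qv : fieldType := {fraction {poly rat}}.
Definition vq : Qv := tofrac 'X.

Definition lpoly (F : fieldType) (x : F) (P : {poly int}) (m : nat) : F :=
  (map_poly intr P).[x] / x ^+ m.

Lemma lpolyD (F : fieldType) (x : F) P m P' m' : x != 0 ->
  lpoly x P m + lpoly x P' m' = lpoly x (P * 'X^m' + P' * 'X^m) (m + m').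
Proof.
move=> x0; rewrite /lpoly !(rmorphD, rmorphM) /= !map_polyXn !hornerE exprD.
by rewrite addf_div ?expf_neq0.
Qed.

Lemma lpolyM (F : fieldType) (x : F) P m P' m' :
  lpoly x P m * lpoly x P' m' = lpoly x (P * P') (m + m').
Proof. by rewrite /lpoly rmorphM /= hornerM exprD mulf_div. Qed.

Lemma lpolyN (F : fieldType) (x : F) P m : - lpoly x P m = lpoly x (- P) m.
Proof. by rewrite /lpoly rmorphN /= hornerN mulNr. Qed.

Lemma lpoly1 (F : fieldType) (x : F) : lpoly x 1 0 = 1.
Proof. by rewrite /lpoly rmorph1 hornerC expr0 divr1. Qed.

Lemma vq_neq0 : vq != 0.
Proof. by rewrite tofrac_eq0 polyX_eq0. Qed.

Lemma horner_vq (P : {poly int}) :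
  (map_poly intr P).[vq] = tofrac (map_poly intr P : {poly rat}).
Proof.
elim/poly_ind: P => [|P c IH]; first by rewrite !rmorph0 horner0.
rewrite !(rmorphD, rmorphM) /= !map_polyX !map_polyC /= !hornerE IH.
by rewrite !rmorph_int.
Qed.

Lemma horner_vq_inj (P P' : {poly int}) :
  (map_poly intr P).[vq] = (map_poly intr P').[vq] -> P = P'.
Proof.
rewrite !horner_vq => /eqP; rewrite tofrac_eq => /eqP.
by apply: map_inj_poly => //; apply: intr_inj.
Qed.

Lemma lpoly_vq_eq (F : fieldType) (x : F) P m P' m' : x != 0 ->
  lpoly vq P m = lpoly vq P' m' -> lpoly x P m = lpoly x P' m'.
Proof.
move=> x0 /eqP; rewrite /lpoly eqr_div ?expf_neq0 ?vq_neq0 // => /eqP E.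
have {}E : P * 'X^m' = P' * 'X^m.
  by apply: horner_vq_inj; rewrite !rmorphM /= !map_polyXn !hornerE E.
apply/eqP; rewrite eqr_div ?expf_neq0 //; apply/eqP.
have := congr1 (fun R : {poly int} => (map_poly intr R).[x]) E.
by rewrite /= !rmorphM /= !map_polyXn !hornerE.
Qed.

Definition laurent : {pred Qv} :=
  fun x => `[< exists P m, x = lpoly vq P m >].

Fact laurent_subring : GRing.subring_closed laurent.
Proof.
split.
- by apply/asboolP; exists 1, 0%N; rewrite lpoly1.
- move=> x y /asboolP[P [m ->]] /asboolP[P' [m' ->]]; apply/asboolP.
  by do 2!eexists; rewrite lpolyN lpolyD ?vq_neq0.
- move=> x y /asboolP[P [m ->]] /asboolP[P' [m' ->]]; apply/asboolP.
  by do 2!eexists; rewrite lpolyM.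
Qed.
HB.instance Definition _ :=
  GRing.isSubringClosed.Build Qv laurent laurent_subring.

(* Z[v, v^-1] as a subring of Q(v). *)
Record Zv : Type := MkZv { zval :> Qv; _ : zval \in laurent }.
HB.instance Definition _ := [isSub for zval].
HB.instance Definition _ := [Choice of Zv by <:].
HB.instance Definition _ := [SubChoice_isSubComNzRing of Zv by <:].

Lemma Zv_lpoly (z : Zv) : exists p : {poly int} * nat, zval z = lpoly vq p.1 p.2.
Proof. by case: z => z /= /asboolP[P [m ->]]; exists (P, m). Qed.

(* The specialization v ↦ q. *)
Section Spec.
Variables (k : fieldType) (q : k) (q_neq0 : q != 0).

Definition spec of q != 0 := fun z : Zv =>
  let p := sval (cid (Zv_lpoly z)) in lpoly q p.1 p.2.

Lemma specE (z : Zv) P m : zval z = lpoly vq P m -> spec q_neq0 z = lpoly q P m.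
Proof.
rewrite /spec; case: cid => p /= -> E.
exact: lpoly_vq_eq q_neq0 E.
Qed.

Fact spec_zmod_morphism : zmod_morphism (spec q_neq0).
Proof.
move=> z z'; have [[P m] /= E] := Zv_lpoly z; have [[P' m'] /= E'] := Zv_lpoly z'.
have Ed : zval (z - z') = lpoly vq (P * 'X^m' + - P' * 'X^m) (m + m').
  by rewrite -lpolyD ?vq_neq0 // -lpolyN -E -E' -[zval]/(val) rmorphB.
by rewrite (specE E) (specE E') (specE Ed) lpolyN lpolyD.
Qed.

Fact spec_monoid_morphism : monoid_morphism (spec q_neq0).
Proof.
split; first by rewrite (@specE 1 1 0%N) ?lpoly1.
move=> z z'; have [[P m] /= E] := Zv_lpoly z; have [[P' m'] /= E'] := Zv_lpoly z'.
have Em : zval (z * z') = lpoly vq (P * P') (m + m').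
  by rewrite -lpolyM -E -E' -[zval]/(val) rmorphM.
by rewrite (specE E) (specE E') (specE Em) lpolyM.
Qed.

HB.instance Definition _ :=
  GRing.isZmodMorphism.Build Zv k (spec q_neq0) spec_zmod_morphism.
HB.instance Definition _ :=
  GRing.isMonoidMorphism.Build Zv k (spec q_neq0) spec_monoid_morphism.
End Spec.

(* ------------------------------------------------------------------ *)
(* The free algebra k<G>.  Its operations are those of {malg k[{fmonom G}]},
   locked because failing unification problems would unfold them without
   bound. *)
Definition free_alg (k : comNzRingType) (G : choiceType) : Type :=
  {malg k[{fmonom G}]}.

HB.lock Definition fa_zero (k : comNzRingType) (G : choiceType) :
  free_alg k G := 0 : {malg k[{fmonom G}]}.
HB.lock Definition fa_one (k : comNzRingType) (G : choiceType) :
  free_alg k G := 1 : {malg k[{fmonom G}]}.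
HB.lock Definition fa_opp (k : comNzRingType) (G : choiceType)
  (x : free_alg k G) : free_alg k G := - (x : {malg k[{fmonom G}]}).
HB.lock Definition fa_add (k : comNzRingType) (G : choiceType)
  (x y : free_alg k G) : free_alg k G := (x : {malg k[{fmonom G}]}) + y.
HB.lock Definition fa_mul (k : comNzRingType) (G : choiceType)
  (x y : free_alg k G) : free_alg k G := (x : {malg k[{fmonom G}]}) * y.
HB.lock Definition fa_scale (k : comNzRingType) (G : choiceType)
  (c : k) (x : free_alg k G) : free_alg k G := c *: (x : {malg k[{fmonom G}]}).

Section FreeAlgebra.
Variables (k : comNzRingType) (G : choiceType).
Local Notation malg := {malg k[{fmonom G}]}.
Local Notation free_alg := (free_alg k G).
HB.instance Definition _ := Choice.on free_alg.

Definition fa_unlock := (fa_zero.unlock, fa_one.unlock, fa_opp.unlock,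
  fa_add.unlock, fa_mul.unlock, fa_scale.unlock).

Fact fa_addA : associative (@fa_add k G).
Proof. by rewrite fa_unlock; apply: (@addrA malg). Qed.
Fact fa_addC : commutative (@fa_add k G).
Proof. by rewrite fa_unlock; apply: (@addrC malg). Qed.
Fact fa_add0 : left_id (@fa_zero k G) (@fa_add k G).
Proof. by rewrite !fa_unlock; apply: (@add0r malg). Qed.
Fact fa_addN : left_inverse (@fa_zero k G) (@fa_opp k G) (@fa_add k G).
Proof. by rewrite !fa_unlock; apply: (@addNr malg). Qed.
HB.instance Definition _ := GRing.isZmodule.Build free_alg
  fa_addA fa_addC fa_add0 fa_addN.

Lemma fa_zeroE : (0 : free_alg) = (0 : malg).
Proof. by rewrite -[LHS]/(@fa_zero k G) fa_unlock. Qed.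
Lemma fa_addE (x y : free_alg) : x + y = ((x : malg) + y : malg).
Proof. by rewrite -[LHS]/(fa_add x y) fa_unlock. Qed.

Fact fa_mulA : associative (@fa_mul k G).
Proof. by rewrite fa_unlock; apply: (@mulrA malg). Qed.
Fact fa_mul1l : left_id (@fa_one k G) (@fa_mul k G).
Proof. by rewrite !fa_unlock; apply: (@mul1r malg). Qed.
Fact fa_mul1r : right_id (@fa_one k G) (@fa_mul k G).
Proof. by rewrite !fa_unlock; apply: (@mulr1 malg). Qed.
Fact fa_mulDl : left_distributive (@fa_mul k G) +%R.
Proof. by move=> x y z; rewrite !fa_addE fa_unlock; apply: (@mulrDl malg). Qed.
Fact fa_mulDr : right_distributive (@fa_mul k G) +%R.
Proof. by move=> x y z; rewrite !fa_addE fa_unlock; apply: (@mulrDr malg). Qed.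
Fact fa_one_neq0 : @fa_one k G != 0.
Proof. by rewrite fa_zeroE fa_unlock; apply: (@oner_neq0 malg). Qed.
HB.instance Definition _ := GRing.Zmodule_isNzRing.Build free_alg
  fa_mulA fa_mul1l fa_mul1r fa_mulDl fa_mulDr fa_one_neq0.

Fact fa_scaleA c c' x :
  @fa_scale k G c (fa_scale c' x) = fa_scale (c * c') x.
Proof. by rewrite fa_unlock; apply: (@scalerA _ malg). Qed.
Fact fa_scale1 : left_id 1 (@fa_scale k G).
Proof. by rewrite fa_unlock; apply: (@scale1r _ malg). Qed.
Fact fa_scaleDr : right_distributive (@fa_scale k G) +%R.
Proof. by move=> c x y; rewrite !fa_addE fa_unlock; apply: (@scalerDr _ malg). Qed.
Fact fa_scaleDl x : {morph (@fa_scale k G)^~ x : c c' / c + c'}.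
Proof. by move=> c c'; rewrite !fa_addE fa_unlock; apply: (@scalerDl _ malg). Qed.
HB.instance Definition _ := GRing.Zmodule_isLmodule.Build k free_alg
  fa_scaleA fa_scale1 fa_scaleDr fa_scaleDl.

Lemma fa_oneE : (1 : free_alg) = (1 : malg).
Proof. by rewrite -[LHS]/(@fa_one k G) fa_unlock. Qed.
Lemma fa_mulE (x y : free_alg) : x * y = ((x : malg) * y : malg).
Proof. by rewrite -[LHS]/(fa_mul x y) fa_unlock. Qed.
Lemma fa_scaleE c (x : free_alg) : c *: x = (c *: (x : malg) : malg).
Proof. by rewrite -[LHS]/(fa_scale c x) fa_unlock. Qed.

Fact fa_scaleAl (c : k) (x y : free_alg) : c *: (x * y) = (c *: x) * y.
Proof. by rewrite !(fa_scaleE, fa_mulE); apply: (@scalerAl _ malg). Qed.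
HB.instance Definition _ := GRing.Lmodule_isLalgebra.Build k free_alg fa_scaleAl.

Fact fa_scaleAr (c : k) (x y : free_alg) : c *: (x * y) = x * (c *: y).
Proof.
rewrite !(fa_scaleE, fa_mulE); apply/malgP => m; rewrite mcoeffZ mcoeffMr.
rewrite (mcoeffMrw m (fsubset_refl _) (msuppZ_le c y)) mulr_sumr.
apply: eq_bigr => m2 _; rewrite mulr_sumr; apply: eq_bigr => m1 _.
by rewrite mcoeffZ mulrnAr mulrCA.
Qed.
HB.instance Definition _ := GRing.Lalgebra_isAlgebra.Build k free_alg fa_scaleAr.
End FreeAlgebra.

HB.lock Definition free_gen (k : comNzRingType) (G : choiceType) (g : G) :
  free_alg k G := << fmu g >>.
Arguments free_gen {k G} g.

Section FreeEvalMonom.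
Variables (k : comNzRingType) (G : choiceType) (h : G -> k).
Definition free_eval_monom (m : {fmonom G}) : k := \prod_(g <- m) h g.
Fact free_eval_mmorphism : mmorphism free_eval_monom.
Proof.
split=> [m1 m2|]; last by rewrite /free_eval_monom fm1 big_nil.
by rewrite /free_eval_monom fmM big_cat.
Qed.
HB.instance Definition _ :=
  isMultiplicative.Build _ _ free_eval_monom free_eval_mmorphism.
End FreeEvalMonom.

HB.lock Definition free_eval (k : comNzRingType) (G : choiceType) (h : G -> k)
  (x : free_alg k G) : k := mmap idfun (free_eval_monom h) x.

Section FreeEval.
Variables (k : comNzRingType) (G : choiceType) (h : G -> k).
Lemma free_evalD : {morph free_eval h : x y / x + y}.
Proof. by move=> x y; rewrite free_eval.unlock fa_addE mmapD. Qed.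
Lemma free_evalM : {morph free_eval h : x y / x * y}.
Proof.
move=> x y; rewrite free_eval.unlock fa_mulE.
exact: (rmorphM (mmap idfun (free_eval_monom h) : {rmorphism _ -> _})).
Qed.
Lemma free_eval1 : free_eval h 1 = 1.
Proof. by rewrite free_eval.unlock fa_oneE mmap1. Qed.
Lemma free_evalZ c x : free_eval h (c *: x) = c * free_eval h x.
Proof. by rewrite free_eval.unlock fa_scaleE mmapZ. Qed.
Lemma free_eval_gen g : free_eval h (free_gen g) = h g.
Proof.
rewrite free_eval.unlock free_gen.unlock /= mmapU mul1r /free_eval_monom fmuE.
by rewrite big_seq1.
Qed.
End FreeEval.

Section GenIdeal.
Variables (k : comNzRingType) (A : algType k) (S : A -> Prop).

Inductive gen_ideal : A -> Prop :=
| gen_ideal_gen x : S x -> gen_ideal x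
| gen_ideal0 : gen_ideal 0
| gen_idealD x y : gen_ideal x -> gen_ideal y -> gen_ideal (x + y)
| gen_idealM a x b : gen_ideal x -> gen_ideal (a * x * b).

Definition ideal_pred : {pred A} := fun x => `[< gen_ideal x >].

Fact ideal_zmod_closed : zmod_closed ideal_pred.
Proof.
split; first by apply/asboolP/gen_ideal0.
move=> x y /asboolP Ix /asboolP Iy; apply/asboolP/gen_idealD => //.
by have := gen_idealM (-1) 1 Iy; rewrite mulr1 mulN1r.
Qed.
HB.instance Definition _ := GRing.isZmodClosed.Build A ideal_pred ideal_zmod_closed.

Definition quot_alg : Type := Quotient.quot ideal_pred.
HB.instance Definition _ := GRing.Zmodule.on quot_alg.

Definition qpi (x : A) : quot_alg := \pi_(Quotient.quot ideal_pred) x.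

Lemma qpiP x y : qpi x = qpi y <-> gen_ideal (x - y).
Proof.
split=> [/eqP|I].
  by rewrite /qpi -Quotient.idealrBE => /asboolP.
by apply/eqP; rewrite /qpi -Quotient.idealrBE; apply/asboolP.
Qed.

Definition qrepr (x : quot_alg) : A := repr (x : Quotient.quot ideal_pred).
Lemma qpiK x : qpi (qrepr x) = x. Proof. exact: reprK. Qed.

Lemma qpiD x y : qpi (x + y) = qpi x + qpi y.
Proof. exact: Quotient.pi_add. Qed.

End GenIdeal.

(* Locked, as unification of their unfoldings can diverge. *)
HB.lock Definition q_mul (k : comNzRingType) (A : algType k) (S : A -> Prop)
  (x y : quot_alg S) : quot_alg S := qpi S (qrepr x * qrepr y).
HB.lock Definition q_scale (k : comNzRingType) (A : algType k) (S : A -> Prop)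
  (c : k) (x : quot_alg S) : quot_alg S := qpi S (c *: qrepr x).

Section QuotientAlgebra.
Variables (k : comNzRingType) (A : algType k) (S : A -> Prop).
Local Notation gen_ideal := (gen_ideal S).
Local Notation quot_alg := (quot_alg S).
Local Notation qpi := (qpi S).
Local Notation q_mul := (@q_mul k A S).
Local Notation q_scale := (@q_scale k A S).
Lemma qpi0 : qpi 0 = 0.
Proof. by apply: (addrI (qpi 0)); rewrite -qpiD !addr0. Qed.

Definition q_one : quot_alg := qpi 1.

Lemma q_mulE x y : q_mul (qpi x) (qpi y) = qpi (x * y).
Proof.
rewrite q_mul.unlock; apply/qpiP; rewrite -[_ - _](addrNK (x * qrepr (qpi y))).
rewrite -[X in gen_ideal X]addrA addrAC addrA -mulrBl -addrA -mulrBr.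
apply: gen_idealD.
  rewrite -[X in gen_ideal X]mul1r mulrA; apply: gen_idealM.
  by apply/qpiP; rewrite qpiK.
rewrite -[X in gen_ideal X]mulr1; apply: gen_idealM.
by apply/qpiP; rewrite qpiK.
Qed.

Lemma q_scaleE c x : q_scale c (qpi x) = qpi (c *: x).
Proof.
rewrite q_scale.unlock; apply/qpiP; rewrite -scalerBr -[X in c *: X]mul1r scalerAl -[X in gen_ideal X]mulr1.
by apply: gen_idealM; apply/qpiP; rewrite qpiK.
Qed.

Lemma q_mulA : associative q_mul.
Proof.
by move=> x y z; rewrite -[x]qpiK -[y]qpiK -[z]qpiK !q_mulE mulrA.
Qed.
Lemma q_mul1l : left_id q_one q_mul.
Proof. by move=> x; rewrite -[x]qpiK q_mulE mul1r. Qed.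
Lemma q_mul1r : right_id q_one q_mul.
Proof. by move=> x; rewrite -[x]qpiK q_mulE mulr1. Qed.
Lemma q_mulDl : left_distributive q_mul +%R.
Proof.
by move=> x y z; rewrite -[x]qpiK -[y]qpiK -[z]qpiK -qpiD !q_mulE mulrDl qpiD.
Qed.
Lemma q_mulDr : right_distributive q_mul +%R.
Proof.
by move=> x y z; rewrite -[x]qpiK -[y]qpiK -[z]qpiK -qpiD !q_mulE mulrDr qpiD.
Qed.
HB.instance Definition _ := GRing.Zmodule_isPzRing.Build quot_alg
  q_mulA q_mul1l q_mul1r q_mulDl q_mulDr.

Lemma q_scaleA c c' x : q_scale c (q_scale c' x) = q_scale (c * c') x.
Proof. by rewrite -[x]qpiK !q_scaleE scalerA. Qed.
Lemma q_scale1 : left_id 1 q_scale.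
Proof. by move=> x; rewrite -[x]qpiK q_scaleE scale1r. Qed.
Lemma q_scaleDr : right_distributive q_scale +%R.
Proof.
by move=> c x y; rewrite -[x]qpiK -[y]qpiK -qpiD !q_scaleE scalerDr qpiD.
Qed.
Lemma q_scaleDl x : {morph q_scale^~ x : c c' / c + c'}.
Proof. by move=> c c'; rewrite -[x]qpiK !q_scaleE scalerDl qpiD. Qed.
HB.instance Definition _ := GRing.Zmodule_isLmodule.Build k quot_alg
  q_scaleA q_scale1 q_scaleDr q_scaleDl.

Lemma qpiM x y : qpi (x * y) = qpi x * qpi y. Proof. by rewrite -q_mulE. Qed.
Lemma qpi1 : qpi 1 = 1. Proof. by []. Qed.
Lemma qpiZ c x : qpi (c *: x) = c *: qpi x. Proof. by rewrite -q_scaleE. Qed.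

Lemma q_scaleAl c (x y : quot_alg) : c *: (x * y) = (c *: x) * y.
Proof. by rewrite -[x]qpiK -[y]qpiK -qpiM -!qpiZ -qpiM scalerAl. Qed.
Lemma q_scaleAr c (x y : quot_alg) : c *: (x * y) = x * (c *: y).
Proof. by rewrite -[x]qpiK -[y]qpiK -qpiM -!qpiZ -qpiM scalerAr. Qed.

Lemma qpi_rel x : S x -> qpi x = 0.
Proof. by move=> Sx; rewrite -qpi0; apply/qpiP; rewrite subr0; apply: gen_ideal_gen. Qed.

Section Factor.
Variables (eps : A -> k).
Hypothesis epsD : {morph eps : x y / x + y}.
Hypothesis epsM : {morph eps : x y / x * y}.
Hypothesis eps_rel : forall x, S x -> eps x = 0.

Let eps0 : eps 0 = 0.
Proof. by apply: (addrI (eps 0)); rewrite -epsD !addr0. Qed.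

Lemma eps_ideal x : gen_ideal x -> eps x = 0.
Proof.
elim=> [y|//|y z _ IH _ IH'|a y b _ IH]; first exact: eps_rel.
- by rewrite epsD IH IH' addr0.
- by rewrite !epsM IH mulr0 mul0r.
Qed.

Definition qeps (x : quot_alg) : k := eps (qrepr x).

Lemma qeps_pi x : qeps (qpi x) = eps x.
Proof.
have /eps_ideal : gen_ideal (qrepr (qpi x) - x) by apply/qpiP; rewrite qpiK.
by move=> E; rewrite /qeps -[qrepr _](subrK x) epsD E add0r.
Qed.
End Factor.
End QuotientAlgebra.

(* ------------------------------------------------------------------ *)
(* Quantum numbers [m], [m]^! and Gaussian binomials with v replaced by w. *)
Section QuantumNumbers.
Variable w : Qv.
Definition qint (m : int) : Qv := (w ^ m - w ^ (- m)) / (w - w^-1).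
Definition qfact (m : nat) : Qv := \prod_(1 <= s < m.+1) qint s.
Definition qbin (m : int) (r : nat) : Qv :=
  (\prod_(s < r) qint (m - s%:Z)) / qfact r.
End QuantumNumbers.

Section QuantumGroup.
(* [a i j] is the Cartan integer a_{ij} and [d i] the symmetrizer d_i. *)
Variables (n : nat) (a : 'I_n -> 'I_n -> int) (d : 'I_n -> nat).

Definition vd (i : 'I_n) : Qv := vq ^+ d i.

Definition qgen : Type := 'I_n + 'I_n + ('I_n + 'I_n).
HB.instance Definition _ := Choice.on qgen.

Definition fE (i : 'I_n) : free_alg Qv qgen := free_gen (inl (inl i)).
Definition fF (i : 'I_n) : free_alg Qv qgen := free_gen (inl (inr i)).
Definition fK (i : 'I_n) : free_alg Qv qgen := free_gen (inr (inl i)).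
Definition fKV (i : 'I_n) : free_alg Qv qgen := free_gen (inr (inr i)).

(* The exponent 1 - a_{ij} is a natural number for a Cartan matrix. *)
Definition serre (X : 'I_n -> free_alg Qv qgen) (i j : 'I_n) :=
  let N := `|1 - a i j|%N in
  \sum_(s < N.+1)
    ((-1) ^+ s * qbin (vd i) N%:Z s) *: (X i ^+ (N - s) * X j * X i ^+ s).

Inductive qgroup_rel : free_alg Qv qgen -> Prop :=
| rel_KK i j : qgroup_rel (fK i * fK j - fK j * fK i)
| rel_KKV i : qgroup_rel (fK i * fKV i - 1)
| rel_KVK i : qgroup_rel (fKV i * fK i - 1)
| rel_KE i j : qgroup_rel (fK i * fE j - vd i ^ a i j *: (fE j * fK i))
| rel_KF i j : qgroup_rel (fK i * fF j - vd i ^ (- a i j) *: (fF j * fK i))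
| rel_EF i j : i != j -> qgroup_rel (fE i * fF j - fF j * fE i)
| rel_EFii i : qgroup_rel
    (fE i * fF i - fF i * fE i - (vd i - (vd i)^-1)^-1 *: (fK i - fKV i))
| rel_serreE i j : i != j -> qgroup_rel (serre fE i j)
| rel_serreF i j : i != j -> qgroup_rel (serre fF i j).

Definition UQ : Type := quot_alg qgroup_rel.
HB.instance Definition _ := GRing.PzRing.on UQ.
HB.instance Definition _ := GRing.Lmodule.on UQ.

(* The counit e_i, f_i ↦ 0, k_i ↦ 1, used here for 1 <> 0 only. *)
Definition counit_gen (g : qgen) : Qv := if g is inr _ then 1 else 0.
Definition free_counit := free_eval counit_gen.

Lemma free_counitB x y : free_counit (x - y) = free_counit x - free_counit y.
Proof. by rewrite -scaleN1r [LHS]free_evalD free_evalZ mulN1r. Qed.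

Lemma serre_counit (X : 'I_n -> free_alg Qv qgen) i j :
  (forall l, free_counit (X l) = 0) -> free_counit (serre X i j) = 0.
Proof.
move=> X0; rewrite /serre; apply: (big_ind (fun x => free_counit x = 0)).
- by rewrite -(subrr 0) free_counitB subrr.
- by move=> x y hx hy; rewrite [LHS]free_evalD [X in X + _]hx [X in _ + X]hy addr0.
- move=> s _; rewrite [LHS]free_evalZ free_evalM free_evalM.
  by rewrite [free_eval _ (X j)]X0 mulr0 mul0r mulr0.
Qed.

Lemma counit_rel x : qgroup_rel x -> free_counit x = 0.
Proof.
have cE i : free_counit (fE i) = 0 by apply: free_eval_gen.
have cF i : free_counit (fF i) = 0 by apply: free_eval_gen.
have cK i : free_counit (fK i) = 1 by apply: free_eval_gen.
have cKV i : free_counit (fKV i) = 1 by apply: free_eval_gen.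
have cB := free_counitB; have cM := free_evalM counit_gen.
have c1 := free_eval1 counit_gen; have cZ := free_evalZ counit_gen.
rewrite /free_counit in cE cF cK cKV cB *.
case=> [i j|i|i|i j|i j|i j _|i|i j _|i j _].
- by rewrite cB !cM !cK subrr.
- by rewrite cB cM cK cKV c1 mulr1 subrr.
- by rewrite cB cM cK cKV c1 mulr1 subrr.
- by rewrite cB cZ !cM cE mulr0 mul0r mulr0 subrr.
- by rewrite cB cZ !cM cF mulr0 mul0r mulr0 subrr.
- by rewrite cB !cM cE cF mulr0 subrr.
- by rewrite !cB cZ cB !cM cE cF cK cKV mulr0 !subrr mulr0 subrr.
- exact: serre_counit cE.
- exact: serre_counit cF.
Qed.

Definition UQ_counit : UQ -> Qv := qeps free_counit.

Lemma UQ_counit_pi (x : free_alg Qv qgen) :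
  UQ_counit (qpi qgroup_rel x) = free_counit x.
Proof. exact: (qeps_pi (@free_evalD _ _ _) (@free_evalM _ _ _) counit_rel). Qed.

Fact UQ_one_neq0 : 1 != 0 :> UQ.
Proof.
apply/eqP => one0.
have : UQ_counit (qpi qgroup_rel 1) = UQ_counit (qpi qgroup_rel 0).
  by congr UQ_counit; rewrite [RHS]qpi0 -[LHS]/(1 : UQ).
rewrite !UQ_counit_pi [LHS]free_eval1 -(subrr 0) free_counitB subrr => /eqP.
by rewrite oner_eq0.
Qed.
HB.instance Definition _ := GRing.PzSemiRing_isNonZero.Build UQ UQ_one_neq0.
HB.instance Definition _ :=
  GRing.Lmodule_isLalgebra.Build Qv UQ (@q_scaleAl _ _ qgroup_rel).
HB.instance Definition _ :=
  GRing.Lalgebra_isAlgebra.Build Qv UQ (@q_scaleAr _ _ qgroup_rel).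

Lemma UQ_counitD : {morph UQ_counit : x y / x + y}.
Proof.
move=> x y; rewrite -[x]qpiK -[y]qpiK.
by rewrite -[_ + _]qpiD !UQ_counit_pi [LHS]free_evalD.
Qed.
Lemma UQ_counitM : {morph UQ_counit : x y / x * y}.
Proof.
move=> x y; rewrite -[x]qpiK -[y]qpiK.
by rewrite -[_ * _]qpiM !UQ_counit_pi [LHS]free_evalM.
Qed.
Lemma UQ_counitZ c x : UQ_counit (c *: x) = c * UQ_counit x.
Proof.
by rewrite -[x]qpiK -[_ *: _]qpiZ !UQ_counit_pi [LHS]free_evalZ.
Qed.
Lemma UQ_counit1 : UQ_counit 1 = 1.
Proof. by rewrite -[1]/(qpi qgroup_rel 1) UQ_counit_pi [LHS]free_eval1. Qed.

Definition qE (i : 'I_n) : UQ := qpi _ (fE i).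
Definition qF (i : 'I_n) : UQ := qpi _ (fF i).
Definition qK (i : 'I_n) : UQ := qpi _ (fK i).
Definition qKV (i : 'I_n) : UQ := qpi _ (fKV i).

Definition divE (i : 'I_n) (m : nat) : UQ := (qfact (vd i) m)^-1 *: qE i ^+ m.
Definition divF (i : 'I_n) (m : nat) : UQ := (qfact (vd i) m)^-1 *: qF i ^+ m.

Definition Kbin (i : 'I_n) (m : nat) : UQ :=
  \prod_(1 <= s < m.+1)
    ((vd i ^ s%:Z - vd i ^ (- s%:Z))^-1 *:
       (vd i ^ (1 - s%:Z) *: qK i - vd i ^ (s%:Z - 1) *: qKV i)).

Inductive UZ_gen : UQ -> Prop :=
| UZ_gen_E i m : UZ_gen (divE i m)
| UZ_gen_F i m : UZ_gen (divF i m)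
| UZ_gen_K i : UZ_gen (qK i)
| UZ_gen_KV i : UZ_gen (qKV i).

(* The Z[v, v^-1]-subalgebra generated by S. *)
Inductive Zsubalg (S : UQ -> Prop) : UQ -> Prop :=
| Zsubalg_gen x : S x -> Zsubalg S x
| Zsubalg1 : Zsubalg S 1
| ZsubalgD x y : Zsubalg S x -> Zsubalg S y -> Zsubalg S (x + y)
| ZsubalgM x y : Zsubalg S x -> Zsubalg S y -> Zsubalg S (x * y)
| ZsubalgZ (z : Zv) x : Zsubalg S x -> Zsubalg S (zval z *: x).

Definition UZ_pred : {pred UQ} := fun x => `[< Zsubalg UZ_gen x >].

Fact UZ_subring : GRing.subring_closed UZ_pred.
Proof.
split.
- by apply/asboolP/Zsubalg1.
- move=> x y /asboolP Ux /asboolP Uy; apply/asboolP/ZsubalgD => //.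
  have := ZsubalgZ (-1) Uy; rewrite -[zval _]/(val (-1 : Zv)).
  by rewrite rmorphN rmorph1 scaleN1r.
- by move=> x y /asboolP Ux /asboolP Uy; apply/asboolP/ZsubalgM.
Qed.
HB.instance Definition _ := GRing.isSubringClosed.Build UQ UZ_pred UZ_subring.

Record UZ : Type := MkUZ { uzval :> UQ; _ : uzval \in UZ_pred }.
HB.instance Definition _ := [isSub for uzval].
HB.instance Definition _ := [Choice of UZ by <:].
HB.instance Definition _ := [SubChoice_isSubNzRing of UZ by <:].

Fact UZ_scale_proof (z : Zv) (x : UZ) : zval z *: uzval x \in UZ_pred.
Proof. by case: x => x /= /asboolP Ux; apply/asboolP/ZsubalgZ. Qed.
Definition UZ_scale (z : Zv) (x : UZ) : UZ := MkUZ (UZ_scale_proof z x).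

Lemma UZ_scaleA z z' x : UZ_scale z (UZ_scale z' x) = UZ_scale (z * z') x.
Proof. by apply: val_inj; rewrite /= scalerA. Qed.
Lemma UZ_scale1 : left_id 1 UZ_scale.
Proof. by move=> x; apply: val_inj; rewrite /= scale1r. Qed.
Lemma UZ_scaleDr : right_distributive UZ_scale +%R.
Proof. by move=> z x y; apply: val_inj; rewrite /= scalerDr. Qed.
Lemma UZ_scaleDl x : {morph UZ_scale^~ x : z z' / z + z'}.
Proof. by move=> z z'; apply: val_inj; rewrite /= scalerDl. Qed.
HB.instance Definition _ := GRing.Zmodule_isLmodule.Build Zv UZ
  UZ_scaleA UZ_scale1 UZ_scaleDr UZ_scaleDl.

Lemma UZ_scaleAl (z : Zv) (x y : UZ) : z *: (x * y) = (z *: x) * y.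
Proof. by apply: val_inj; rewrite /= scalerAl. Qed.
Lemma UZ_scaleAr (z : Zv) (x y : UZ) : z *: (x * y) = x * (z *: y).
Proof. by apply: val_inj; rewrite /= scalerAr. Qed.
HB.instance Definition _ := GRing.Lmodule_isLalgebra.Build Zv UZ UZ_scaleAl.
HB.instance Definition _ := GRing.Lalgebra_isAlgebra.Build Zv UZ UZ_scaleAr.

Fact UZ_counit_proof (x : UZ) : UQ_counit (uzval x) \in laurent.
Proof.
have cg g : UQ_counit (qpi qgroup_rel (free_gen g)) = counit_gen g.
  by rewrite UQ_counit_pi; apply: free_eval_gen.
have div0 i m (X : UQ) : UQ_counit X = 0 ->
    UQ_counit ((qfact (vd i) m)^-1 *: X ^+ m) \in laurent.
  move=> X0; rewrite UQ_counitZ; case: m => [|m].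
    by rewrite expr0 UQ_counit1 mulr1 /qfact big_geq // invr1 rpred1.
  by rewrite exprS UQ_counitM X0 mul0r mulr0 rpred0.
case: x => x /= /asboolP; elim=> {x}.
- by move=> _ [] i *; rewrite ?div0 ?cg ?rpred1.
- by rewrite UQ_counit1 rpred1.
- by move=> x y _ IH _ IH'; rewrite UQ_counitD rpredD.
- by move=> x y _ IH _ IH'; rewrite UQ_counitM rpredM.
- by move=> z x _ IH; rewrite UQ_counitZ rpredM //; case: (z).
Qed.
Definition UZ_counit (x : UZ) : Zv := MkZv (UZ_counit_proof x).

Section Specialized.
Variables (k : fieldType) (q : k) (q_neq0 : q != 0).

(* U_k = U_Z ⊗_Z k for v ↦ q. *)
Definition UK : Type := base_change UZ (spec q_neq0).
HB.instance Definition _ := GRing.PzRing.on UK.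
HB.instance Definition _ := GRing.Lmodule.on UK.

Fact UK_one_neq0 : 1 != 0 :> UK.
Proof.
apply: (@bc_neq0 _ _ _ _ UZ_counit).
- by move=> x y; apply: val_inj; rewrite /= UQ_counitD.
- by move=> z x; apply: val_inj; rewrite /= UQ_counitZ.
- by apply: val_inj; rewrite /= UQ_counit1.
Qed.
HB.instance Definition _ := GRing.PzSemiRing_isNonZero.Build UK UK_one_neq0.
HB.instance Definition _ :=
  GRing.Lmodule_isLalgebra.Build k UK (@bc_scaleAl _ _ _ (spec q_neq0)).
HB.instance Definition _ :=
  GRing.Lalgebra_isAlgebra.Build k UK (@bc_scaleAr _ _ _ (spec q_neq0)).

(* The pure tensor x ⊗ c. *)
Definition uk (x : UZ) (c : k) : UK := bc (spec q_neq0) x c.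

(* The graph of the Z[v, v^-1]-algebra character determined by its values S on
   generators; its domain is the subalgebra they generate. *)
Inductive char_graph (S : UQ -> Qv -> Prop) : UQ -> Qv -> Prop :=
| char_gen x y : S x y -> char_graph S x y
| char1 : char_graph S 1 1
| charD x y x' y' : char_graph S x y -> char_graph S x' y' ->
    char_graph S (x + x') (y + y')
| charM x y x' y' : char_graph S x y -> char_graph S x' y' ->
    char_graph S (x * x') (y * y')
| charZ (z : Zv) x y : char_graph S x y ->
    char_graph S (zval z *: x) (zval z * y).

(* A weight mu enters only through the integers m i = <mu, alpha_i^vee>. *)
Inductive weight_gen (m : 'I_n -> int) : UQ -> Qv -> Prop :=
| weight_gen_K i : weight_gen m (qK i) (vd i ^ m i)
| weight_gen_KV i : weight_gen m (qKV i) (vd i ^ (- m i))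
| weight_gen_Kbin i r : weight_gen m (Kbin i r) (qbin (vd i) (m i) r).

(* The character U_Z^0 -> Z[v, v^-1] attached to a weight. *)
Definition weight_char (m : 'I_n -> int) := char_graph (weight_gen m).

Inductive borel_gen (m : 'I_n -> int) : UQ -> Qv -> Prop :=
| borel_gen_U0 x y : weight_char m x y -> borel_gen m x y
| borel_gen_E i r : (0 < r)%N -> borel_gen m (divE i r) 0.

(* Its extension to U_Z^0 U_Z^+. *)
Definition borel_char (m : 'I_n -> int) := char_graph (borel_gen m).

(* U_k^0 is spanned by the H ⊗ c with H in U_Z^0, the domain of weight_char. *)
Definition weight_space (M : lmodType UK) (m : 'I_n -> int) (x : M) : Prop :=
  forall (H : UZ) (z : Zv) (c : k), weight_char m (uzval H) (zval z) ->
    uk H c *: x = (spec q_neq0 z * c)%:A *: x.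

Definition has_dim (M : lmodType UK) (W : M -> Prop) (N : nat) : Prop :=
  exists b : 'I_N -> M, (forall i, W (b i)) /\
    forall x, W x ->
      exists! c : {ffun 'I_N -> k}, x = \sum_i (c i)%:A *: b i.

(* The pure tensors b ⊗ c with b in U_Z^0 U_Z^+, which span U_k^0 U_k^+,
   together with the value of b at a weight. *)
Record borel_elt (m : 'I_n -> int) := BorelElt {
  borel_val : UZ;
  borel_chi : Zv;
  borel_coef : k;
  _ : borel_char m (uzval borel_val) (zval borel_chi)
}.

Section Verma.
Variable m : 'I_n -> int.

Definition borel_ract (u : UK) (b : borel_elt m) : UK :=
  u * uk (borel_val b) (borel_coef b).
Definition borel_lact (b : borel_elt m) (c : k) : k :=
  spec q_neq0 (borel_chi b) * borel_coef b * c.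

(* U_k ⊗_{U_k^0 U_k^+} k_lambda. *)
Definition verma : Type := tensor borel_ract borel_lact.
HB.instance Definition _ := GRing.Zmodule.on verma.

Definition verma_pure (u : UK) (c : k) : verma :=
  pure borel_ract borel_lact u c.

Definition verma_act (u : UK) : verma -> verma :=
  tlift (fun u' c => verma_pure (u * u') c).

Section Act.
Variable u : UK.
Let f := fun u' c => verma_pure (u * u') c.
Let fDl x x' c : f (x + x') c = f x c + f x' c.
Proof. by rewrite /f mulrDr [LHS]pureDl. Qed.
Let fDr x c c' : f x (c + c') = f x c + f x c'.
Proof. exact: pureDr. Qed.
Let f_bal x b c : f (borel_ract x b) c = f x (borel_lact b c).
Proof. by rewrite /f /borel_ract mulrA; apply: pure_bal. Qed.

Lemma verma_actE u' c : verma_act u (verma_pure u' c) = verma_pure (u * u') c.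
Proof. exact: (tlift_pure fDl fDr f_bal). Qed.
Lemma verma_actD x y : verma_act u (x + y) = verma_act u x + verma_act u y.
Proof. exact: (tliftD fDl fDr f_bal). Qed.
Lemma verma_act0 : verma_act u 0 = 0.
Proof. exact: (tlift0 fDl fDr f_bal). Qed.
End Act.

Lemma verma_ind (P : verma -> Prop) :
  P 0 -> (forall x y, P x -> P y -> P (x + y)) ->
  (forall u c, P (verma_pure u c)) -> forall x, P x.
Proof. exact: tensor_ind. Qed.

Lemma verma_actA u u' x :
  verma_act u (verma_act u' x) = verma_act (u * u') x.
Proof.
elim/verma_ind: x => [|x y IH IH'|u1 c]; first by rewrite !verma_act0.
  by rewrite !verma_actD IH IH'.
by rewrite !verma_actE mulrA.
Qed.
Lemma verma_act1 : left_id 1 verma_act.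
Proof.
elim/verma_ind => [|x y IH IH'|u1 c]; first by rewrite !verma_act0.
  by rewrite verma_actD IH IH'.
by rewrite verma_actE mul1r.
Qed.
Lemma verma_actDl x : {morph verma_act^~ x : u u' / u + u'}.
Proof.
move=> u u'; elim/verma_ind: x => [|x y IH IH'|u1 c].
- by rewrite !verma_act0 addr0.
- by rewrite !verma_actD IH IH' addrACA.
- by rewrite !verma_actE mulrDl [LHS]pureDl.
Qed.
HB.instance Definition _ := GRing.Zmodule_isLmodule.Build UK verma
  verma_actA verma_act1 verma_actD verma_actDl.
End Verma.

End Specialized.
End QuantumGroup.

(* ------------------------------------------------------------------ *)
Definition simple_module (A : pzRingType) (L : lmodType A) : Prop :=
  (exists x : L, x != 0) /\
  forall S : {pred L}, submod_closed S ->
    (forall x, x \in S -> x = 0) \/ (forall x, x \in S).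

Definition irreducible_quotient (A : pzRingType) (M L : lmodType A) : Prop :=
  simple_module L /\ exists pi : {linear M -> L}, forall y, exists x, pi x = y.

(* ------------------------------------------------------------------ *)
(* Reduced (crystallographic) root systems. *)
Record root_system (F : archiRealFieldType) (V : vectType F) := RootSystem {
  roots : seq V;
  coroot : V -> 'Hom(V, F^o);
  _ : 0 \notin roots;
  _ : (<<roots>> = fullv)%VS;
  _ : forall alpha, alpha \in roots -> coroot alpha alpha = 2;
  _ : forall alpha beta, alpha \in roots -> beta \in roots ->
        beta - (coroot alpha beta : F) *: alpha \in roots;
  _ : forall alpha beta, alpha \in roots -> beta \in roots ->
        (coroot alpha beta : F) \is a Num.int;
  _ : forall alpha (c : F), alpha \in roots -> c *: alpha \in roots ->
        c = 1 \/ c = -1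
}.

Section RootData.
Variables (F : archiRealFieldType) (V : vectType F) (R : root_system V).
Variables (n : nat) (Pi : n.-tuple V).

Definition is_root_basis : Prop :=
  [/\ {subset Pi <= roots R}, basis_of fullv Pi &
   forall beta, beta \in roots R -> exists c : 'I_n -> nat,
     beta = \sum_i tnth Pi i *+ c i \/ beta = - (\sum_i tnth Pi i *+ c i)].

Definition is_weight (mu : V) : Prop :=
  forall alpha, alpha \in roots R -> (coroot R alpha mu : F) \is a Num.int.

(* <mu, alpha_i^vee>; the floor is exact on weights. *)
Definition pairing (mu : V) (i : 'I_n) : int :=
  Num.floor (coroot R (tnth Pi i) mu : F).

Definition cartan (i j : 'I_n) : int := pairing (tnth Pi j) i.

Definition weight_le (mu lambda : V) : Prop :=
  exists c : 'I_n -> nat, lambda - mu = \sum_i tnth Pi i *+ c i.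

Definition orthogonal_part (C : {pred V}) : Prop :=
  [/\ {subset C <= roots R}, exists alpha, alpha \in C &
   forall alpha beta, alpha \in C -> beta \in roots R -> beta \notin C ->
     coroot R alpha beta = 0].

Definition irreducible_component (C : {pred V}) : Prop :=
  orthogonal_part C /\
  forall D : {pred V}, orthogonal_part D -> {subset D <= C} -> {subset C <= D}.

Definition is_symmetrizer (d : 'I_n -> nat) : Prop :=
  [/\ forall i, (d i \in [:: 1; 2; 3])%N,
      forall i j, (d i)%:Z * cartan i j = (d j)%:Z * cartan j i &
      forall C, irreducible_component C ->
        exists i, tnth Pi i \in C /\ d i = 1%N].
End RootData.

(* Main.v *)
From HB Require Import structures.
Require Import Defs.
From mathcomp Require Import all_boot all_order all_algebra.
From mathcomp Require Import boolp ring zify.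

Set Implicit Arguments.
Unset Strict Implicit.
Unset Printing Implicit Defensive.

Import Order.TTheory GRing.Theory Num.Theory.
Local Open Scope ring_scope.

(** Write [ch(m, t)] for the binomial coefficient of an integer [m] over [t],
    read in [K].  At q = 1 a weight [m] acts on [U_K^0] through the scalars
    [ch(m i, t)], and on a vector of weight [m] divided powers commute by
      [E_i^(b) F_i^(c) = \sum_t ch(m i + b - c, t) F_i^(c-t) E_i^(b-t)],
    the sum being over [t <= min(b, c)].  In characteristic [p] the function
    [ch(m, t)] has period [p^r] in [m] as soon as [t < p^r]; so, as long as only
    divided powers with exponents below [p^r] occur, the commutation rules over
    [lambda] and over [lambda + p^r gamma] are literally the same.

    To turn this into an isomorphism of weight spaces without choosing bases of
    [U^-] or a contravariant form, consider the two irreducible modules [L],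
    [L'] together, with highest weight vectors [v], [v'].  For
    [nu = \sum_i nu_i alpha_i] let [D_nu] in [L * L'] be the span of all
    [y (v, v')] with [y] a product of divided powers of the [F_i] of total degree
    [nu] ([Fspan]).  The projections of [D_nu] to the two factors are the weight
    spaces of weight [lambda - nu] and [lambda + p^r gamma - nu]
    ([pair_fst_onto], [pair_snd_onto]).  If all [nu_i < p^r], raising operators
    map [D_nu] to smaller [D_nu'] ([pair_raise]).  Both projections are then
    injective ([pair_inj]): if [(x, 0)] is in [D_nu] and [x != 0], then some
    [E_i^(b) x] is nonzero, since a vector of [L] killed by all raising operators
    and of weight other than [lambda] would generate a proper submodule
    ([primitive_eq0]); descending to [nu = 0] one gets a nonzero vector [(x, 0)]
    on the line through [(v, v')], which is absurd.  Hence [D_nu] is the graph of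
    an isomorphism between the two weight spaces
    ([weight_spaces_same_dim]).

    What has to be known about [U_K] is modest: the commutation rule of divided
    powers ([divpow_comm]), which also puts the elements [K; c over t] into
    [U_Z] and makes the span of the words in the [F_i^(b)] applied to a vector
    killed by all [E_i^(b)] stable under the [E_i^(b)]; that the binomials
    separate integers in characteristic [p] ([pascal_separates]);
    and that the Cartan matrix is invertible ([cartan_unit]), so that distinct [nu]
    give distinct weights. *)

(** * Divided powers in quantum sl2 *)

Section QuantumSl2.
Variables (Q : fieldType) (w : Q).
Hypothesis w_neq0 : w != 0.
Hypothesis w_gen : forall s : nat, (0 < s)%N -> w ^ s%:Z - w ^ (- s%:Z) != 0.

(** Quantum numbers in an arbitrary field; over [Qv] they are [qint], [qfact] and,
    for [gbin] below, [qbin] by conversion. *)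
Definition gint (m : int) : Q := (w ^ m - w ^ (- m)) / (w - w^-1).
Definition gfact (m : nat) : Q := \prod_(1 <= s < m.+1) gint s.

Let ww1 : w - w^-1 != 0. Proof. exact: (@w_gen 1). Qed.

Lemma gint_nat_neq0 s : (0 < s)%N -> gint s%:Z != 0.
Proof.
by move=> s0; rewrite /gint mulf_neq0 ?invr_neq0 ?w_gen.
Qed.

Lemma gfact0 : gfact 0 = 1. Proof. by rewrite /gfact big_geq. Qed.

Lemma gint1 : gint 1 = 1.
Proof. exact: mulfV. Qed.

Lemma gint0 : gint 0 = 0.
Proof. by rewrite /gint oppr0 subrr mul0r. Qed.

Lemma gfactS s : gfact s.+1 = gint s.+1%:Z * gfact s.
Proof. by rewrite /gfact big_nat_recr //= mulrC. Qed.

Section Cartan.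
Variables (A : algType Q) (k kv : A).
Hypotheses (k_kv : k * kv = 1) (kv_k : kv * k = 1).

(** Up to the factor [(w - w^-1)^-1], the element [K; c] of the torus; [kbin c t]
    is [K; c over t]. *)
Definition kshift (c : int) : A := w ^ c *: k - w ^ (- c) *: kv.

Definition kbin (c : int) (t : nat) : A :=
  \prod_(s < t) ((w ^ s.+1%:Z - w ^ (- s.+1%:Z))^-1 *: kshift (c - s%:Z)).

Let den (t : nat) : Q := \prod_(s < t) (w ^ s.+1%:Z - w ^ (- s.+1%:Z)).
Let num (c : int) (t : nat) : A := \prod_(s < t) kshift (c - s%:Z).

Let kbinE c t : kbin c t = (den t)^-1 *: num c t.
Proof.
rewrite /kbin /den /num; elim: t => [|t IH].
  by rewrite !big_ord0 invr1 scale1r.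
by rewrite !big_ord_recr /= IH invfM -scalerAl -scalerAr scalerA.
Qed.

Lemma kbin0 c : kbin c 0 = 1. Proof. by rewrite /kbin big_ord0. Qed.

Lemma kshiftC c c' : kshift c * kshift c' = kshift c' * kshift c.
Proof.
rewrite /kshift !mulrBl !mulrBr -!scalerAl -!scalerAr !scalerA k_kv kv_k.
rewrite [w ^ c' * w ^ c]mulrC [w ^ (- c') * w ^ (- c)]mulrC.
rewrite [w ^ (- c') * _]mulrC [w ^ (- c) * w ^ c']mulrC.
by rewrite !opprB addrACA [RHS]addrACA; congr (_ + _); rewrite addrC.
Qed.

Let num_shiftC c' c t : kshift c' * num c t = num c t * kshift c'.
Proof.
rewrite /num; elim: t => [|t IH]; first by rewrite big_ord0 mulr1 mul1r.
by rewrite big_ord_recr /= mulrA IH -!mulrA kshiftC.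
Qed.

Let numSl c t : num c t.+1 = kshift c * num (c - 1) t.
Proof.
rewrite /num big_ord_recl subr0; congr (_ * _); apply: eq_bigr => s _.
by congr kshift; rewrite lift0 -addn1 PoszD; ring.
Qed.

Let numSr c t : num c t.+1 = kshift (c - t%:Z) * num c t.
Proof. by rewrite num_shiftC /num big_ord_recr. Qed.

(** The addition formula
    [[m + m'] w^u = [m] w^(u + m') + [m'] w^(u - m)], applied to the two terms of
    [kshift]. *)
Lemma gint_kshift m m' u :
  gint (m + m') *: kshift u
  = gint m *: kshift (u + m') + gint m' *: kshift (u - m).
Proof.
have gint_expz x y z : gint (x + y) * w ^ z
    = gint x * w ^ (z + y) + gint y * w ^ (z - x).
  rewrite /gint !(mulrAC _ (_ - _)^-1) -mulrDl; congr (_ / _).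
  rewrite !mulrBl -!expfzDr //.
  rewrite (_ : y + (z - x) = - x + (z + y)); last by ring.
  rewrite addrA addrNK.
  by congr (w ^ _ - w ^ _); ring.
rewrite /kshift !scalerBr !scalerA addrACA -opprD -!scalerDl gint_expz.
congr (_ - _ *: kv).
by rewrite [m + m']addrC gint_expz opprD opprB addrC [- u + m]addrC.
Qed.

(** Pascal's rule: [kbin (c + 1) t.+1] and [kbin c t.+1] share all their factors
    but one. *)
Lemma kbin_pascal c t :
  kbin (c + 1) t.+1 =
  w ^ t.+1%:Z *: kbin c t.+1 + w ^ (t%:Z - c) *: (kv * kbin c t).
Proof.
have ks : kshift (c + 1) = w ^ t.+1%:Z *: kshift (c - t%:Z)
    + (w ^ (t%:Z - c) * (w ^ t.+1%:Z - w ^ (- t.+1%:Z))) *: kv.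
  rewrite /kshift scalerBr !scalerA -!expfzDr // -addrA -scaleNr -scalerDl.
  rewrite mulrBr -!expfzDr //.
  rewrite (_ : t.+1%:Z - (c - t%:Z) = t%:Z - c + t.+1%:Z); last by lia.
  by rewrite addKr scaleNr; congr (w ^ _ *: k - w ^ _ *: kv); lia.
rewrite !kbinE numSl addrK ks numSr mulrDl scalerDr; congr (_ + _).
  by rewrite -scalerAl !scalerA mulrC.
rewrite -!scalerAl -scalerAr !scalerA; congr (_ *: _).
rewrite /den big_ord_recr /= invfM -/(den t).
by rewrite [w ^ (t%:Z - c) * _]mulrC mulrA mulfVK ?w_gen // mulrC.
Qed.

Section QCommute.
Variables (x : A) (e : int).
Hypothesis kx : k * x = w ^ e *: (x * k).
Hypothesis kvx : kv * x = w ^ (- e) *: (x * kv).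

Lemma kshift_mul c : kshift c * x = x * kshift (c + e).
Proof.
rewrite /kshift mulrBl mulrBr -!scalerAl -!scalerAr kx kvx !scalerA.
by rewrite -!expfzDr // opprD.
Qed.

Lemma kbin_mul c t : kbin c t * x = x * kbin (c + e) t.
Proof.
rewrite /kbin; elim: t => [|t IH]; first by rewrite !big_ord0 mulr1 mul1r.
rewrite !big_ord_recr /= -mulrA -scalerAl kshift_mul scalerAr mulrA IH -mulrA.
by rewrite addrAC.
Qed.
End QCommute.

Section RaiseLower.
Variables (e f : A).
Hypothesis kf : k * f = w ^ (- 2%:Z) *: (f * k).
Hypothesis kvf : kv * f = w ^ (- - 2%:Z) *: (f * kv).
Hypothesis ke : k * e = w ^ 2%:Z *: (e * k).
Hypothesis kve : kv * e = w ^ (- 2%:Z) *: (e * kv).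
Hypothesis ef : e * f - f * e = (w - w^-1)^-1 *: (k - kv).

Definition divpow (x : A) (b : nat) : A := (gfact b)^-1 *: x ^+ b.

Lemma divpow0 x : divpow x 0 = 1.
Proof. by rewrite /divpow gfact0 invr1 scale1r. Qed.

Lemma mul_divpow x b : x * divpow x b = gint b.+1%:Z *: divpow x b.+1.
Proof.
rewrite /divpow -scalerAr -exprS scalerA gfactS invfM mulrA mulfV ?mul1r //.
exact: gint_nat_neq0.
Qed.

Let kappa : Q := (w - w^-1)^-1.

Let kshift_f c : kshift c * f = f * kshift (c - 2).
Proof. exact: kshift_mul. Qed.

Lemma kbin_e c t : e * kbin c t = kbin (c - 2) t * e.
Proof. by rewrite (kbin_mul ke) // addrNK. Qed.

Lemma e_fpow b : e * f ^+ b.+1 =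
  f ^+ b.+1 * e + (gint b.+1%:Z * kappa) *: (f ^+ b * kshift (- b%:Z)).
Proof.
have ef' : e * f = f * e + kappa *: kshift 0.
  by rewrite /kshift oppr0 !expr0z !scale1r -ef addrC subrK.
elim: b => [|b IH].
  by rewrite expr1 mul1r ef' /gint mulfV // mul1r.
rewrite exprSr mulrA IH mulrDl -mulrA ef' mulrDr mulrA -exprSr -addrA.
congr (_ + _).
rewrite -[X in _ + X]scalerAl -[f ^+ b * _ * f]mulrA kshift_f mulrA -exprSr.
rewrite -scalerAr scalerAr [X in _ + X]scalerAr -mulrDr [RHS]scalerAr.
congr (_ * _); have := gint_kshift 1 b.+1%:Z (- b.+1%:Z).
rewrite gint1 scale1r addNr -opprD -(PoszD b.+1 1) -(PoszD 1 b.+1) addn1 add1n.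
move=> E; rewrite (mulrC (gint b.+1%:Z)) (mulrC (gint b.+2%:Z)).
rewrite -!(scalerA kappa).
by rewrite -scalerDr E; congr (_ *: (_ + _ *: kshift _)); lia.
Qed.

Lemma e_divpow b : e * divpow f b.+1 =
  divpow f b.+1 * e + kappa *: (divpow f b * kshift (- b%:Z)).
Proof.
rewrite /divpow -scalerAr e_fpow scalerDr -!scalerAl; congr (_ + _).
rewrite !scalerA; congr (_ *: _).
rewrite mulrA [RHS]mulrC; congr (_ * _).
by rewrite gfactS invfM mulrAC mulVf ?mul1r // gint_nat_neq0.
Qed.

(* The coefficient identity behind the induction step of divpow_comm. *)
Let coef_rec (a b t : int) (s : nat) : t = s%:Z ->
  gint (a + 1) *: kbin ((t + 1) * 2 - (a + 1) - b) s.+1 =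
  gint (a - t) *: kbin ((t + 1) * 2 - a - b - 2) s.+1
  + kappa *: (kshift (t + 1 - b) * kbin (t * 2 - a - b) s).
Proof.
move=> ts; rewrite !kbinE numSl.
set c := t * 2 - a - b.
have -> : (t + 1) * 2 - (a + 1) - b = c + 1 by rewrite /c; ring.
have -> : (t + 1) * 2 - a - b - 2 = c by rewrite /c; ring.
have denS : (den s.+1)^-1 * gint (t + 1) = kappa * (den s)^-1.
  rewrite {1}/den big_ord_recr /= invfM -/(den s) ts -(PoszD s 1) addn1.
  by rewrite /gint mulrA mulfVK ?w_gen // mulrC.
rewrite addrK numSr -!scalerAr !scalerA -denS.
rewrite ![_ * (den s.+1)^-1]mulrC -!(scalerA (den s.+1)^-1) -scalerDr.
congr (_ *: _); rewrite !scalerAl -mulrDl; congr (_ * _).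
rewrite (_ : a + 1 = t + 1 + (a - t)); last by ring.
rewrite gint_kshift addrC; congr (_ *: kshift _ + _ *: kshift _).
  by rewrite /c ts; ring.
by rewrite /c; ring.
Qed.

(** In the induction on [a], multiplying the [t]-th term by [e] on the left gives
    two terms: [e] passes to the right of [f^(b-t)], or is absorbed by it.  The
    first again has index [t], the second index [t + 1], and [coef_rec] adds up
    the contributions to each index. *)
Lemma divpow_comm a b : divpow e a * divpow f b =
  \sum_(t < a.+1 | (t <= b)%N)
     divpow f (b - t) * kbin (t%:Z * 2 - a%:Z - b%:Z) t * divpow e (a - t).
Proof.
elim: a => [|a IH].
  by rewrite big_mkcond big_ord1 /= kbin0 !divpow0 subn0 mul1r !mulr1.
apply: (scalerI (@gint_nat_neq0 a.+1 isT)).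
rewrite [LHS]scalerAl -mul_divpow -mulrA IH mulr_sumr.
pose T1 t := gint (a%:Z + 1 - t%:Z) *:
  (divpow f (b - t) * kbin (t%:Z * 2 - a%:Z - b%:Z - 2) t * divpow e (a.+1 - t)).
pose T2 t := kappa *: (divpow f (b - t.+1) * (kshift (t%:Z + 1 - b%:Z) *
  kbin (t%:Z * 2 - a%:Z - b%:Z) t) * divpow e (a - t)).
transitivity (\sum_(t < a.+1 | (t <= b)%N) T1 t
  + \sum_(t < a.+1 | (t < b)%N) T2 t).
  rewrite [X in _ = _ + X]big_mkcond [X in X + _]big_mkcond [LHS]big_mkcond.
  rewrite -big_split; apply: eq_bigr => t _ /=.
  have ta : (t <= a)%N by rewrite -ltnS.
  case: (leqP t b) => tb; last by rewrite [(t < b)%N]ltnNge ltnW ?addr0.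
  have T1E : divpow f (b - t) * e * kbin (t%:Z * 2 - a%:Z - b%:Z) t
      * divpow e (a - t) = T1 t.
    rewrite /T1 -(mulrA (divpow f _)) kbin_e -!mulrA mul_divpow.
    rewrite -!scalerAr -subSn // mulrA; congr (gint _ *: _); lia.
  case: ltnP => tb'.
    have bt : (b - t = (b - t.+1).+1)%N by rewrite subnSK.
    rewrite !mulrA bt e_divpow -bt !mulrDl T1E; congr (_ + _).
    rewrite /T2 -!(scalerAl kappa) !mulrA.
    by congr (_ *: (_ * kshift _ * _ * _)); lia.
  have /eqP bt : (b - t == 0)%N by rewrite subn_eq0.
  by rewrite addr0 -T1E bt divpow0 !mulrA mulr1 mul1r.
(* The extra term t = a + 1 vanishes, its coefficient being the quantum integer [0]. *)
have -> : \sum_(t < a.+1 | (t <= b)%N) T1 t = \sum_(t < a.+2 | (t <= b)%N) T1 t.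
  rewrite [LHS]big_mkcond [RHS]big_mkcond [RHS]big_ord_recr /=.
  by rewrite /T1 -(PoszD a 1) addn1 subrr gint0 scale0r if_same addr0.
rewrite [X in X + _]big_mkcond [X in _ + X]big_mkcond scaler_sumr.
rewrite [RHS]big_mkcond [X in X + _]big_ord_recl [RHS]big_ord_recl -addrA.
congr (_ + _).
  by rewrite /T1 !kbin0 subr0 -(PoszD a 1) addn1.
rewrite -big_split; apply: eq_bigr => t _ /=.
rewrite /bump leq0n add1n; case: ifP => // tb; last by rewrite addr0.
rewrite /T1 /T2 subSS; move: (divpow f _) (divpow e _) => x y.
rewrite !(scalerAl _ _ y) -mulrDl !(scalerAr _ x) -mulrDr; congr (_ * _ * _).
rewrite -(PoszD a 1) addn1; have := @coef_rec a b t t erefl.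
rewrite -(PoszD a 1) -(PoszD t 1) !addn1 => ->.
by congr (gint _ *: _ + _); lia.
Qed.
End RaiseLower.
End Cartan.

Definition gbin (m : int) (r : nat) : Q :=
  (\prod_(s < r) gint (m - s%:Z)) / gfact r.

(** The scalars [gbin m r] are the [kbin m r] of the trivial torus element, so
    they satisfy the same recursion. *)
Lemma gbin_kbin m r : gbin m r = @kbin Q^o 1 1 m r.
Proof.
rewrite /gbin /kbin; elim: r => [|r IH].
  by rewrite !big_ord0 gfact0 divr1.
rewrite !big_ord_recr /= -IH gfactS invfM (mulrC (gint r.+1%:Z)^-1).
rewrite mulrACA.
congr (_ * _); have scaleE (x y : Q) : x *: (y : Q^o) = x * y by [].
rewrite scaleE /kshift !scaleE !mulr1 /gint invf_div.
by rewrite mulrA mulfVK // mulrC.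
Qed.

Lemma gbin0 m : gbin m 0 = 1.
Proof. by rewrite /gbin big_ord0 gfact0 divr1. Qed.

Lemma gbin_pascal m t :
  gbin (m + 1) t.+1 = w ^ t.+1%:Z * gbin m t.+1 + w ^ (t%:Z - m) * gbin m t.
Proof. by rewrite !gbin_kbin kbin_pascal ?mul1r. Qed.
End QuantumSl2.

(** * The torus part of the integral form *)

Lemma qbinE w m r : qbin w m r = @gbin Qv w m r. Proof. by []. Qed.

Lemma vq_expr_neq1 N : (0 < N)%N -> vq ^+ N != 1.
Proof.
move=> N0; rewrite /vq -rmorphXn -(rmorph1 (@tofrac _)) tofrac_eq.
apply/eqP => /(congr1 (fun P : {poly rat} => size P)).
by rewrite size_polyXn size_poly1; case: N N0.
Qed.

Section Generators.
Variables (n : nat) (a : 'I_n -> 'I_n -> int) (d : 'I_n -> nat).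
Hypothesis d_gt0 : forall i, (0 < d i)%N.
Hypothesis a_diag : forall i, a i i = 2.

Local Notation UQ := (UQ a d).
Local Notation vd := (vd d).
Local Notation qE := (qE a d).
Local Notation qF := (qF a d).
Local Notation qK := (qK a d).
Local Notation qKV := (qKV a d).
Local Notation UZ_pred := (@UZ_pred n a d).

Lemma vd_neq0 i : vd i != 0.
Proof. by rewrite expf_neq0 // vq_neq0. Qed.

Lemma vd_gen i (s : nat) : (0 < s)%N -> vd i ^ s%:Z - vd i ^ (- s%:Z) != 0.
Proof.
move=> s0; rewrite subr_eq0 -invr_expz; apply/eqP => E.
have : vd i ^+ s * vd i ^+ s = 1.
  by rewrite -[X in X * _]/(vd i ^ s%:Z) E mulVf // expf_neq0 // vd_neq0.
rewrite -exprD -exprM => /eqP; apply/negP/vq_expr_neq1.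
by rewrite muln_gt0 d_gt0 addn_gt0 s0.
Qed.

Lemma qpi_eq x y : qgroup_rel a d (x - y) -> qpi (qgroup_rel a d) x = qpi _ y.
Proof. by move=> r; apply/qpiP/gen_ideal_gen. Qed.

Lemma qK_KV i : qK i * qKV i = 1.
Proof. by rewrite -[LHS]qpiM; apply: qpi_eq; apply: rel_KKV. Qed.

Lemma qKV_K i : qKV i * qK i = 1.
Proof. by rewrite -[LHS]qpiM; apply: qpi_eq; apply: rel_KVK. Qed.

Lemma qK_E i j : qK i * qE j = vd i ^ a i j *: (qE j * qK i).
Proof.
rewrite -[LHS]qpiM -[qE j * _]qpiM -[RHS]qpiZ.
by apply: qpi_eq; apply: rel_KE.
Qed.

Lemma qK_F i j : qK i * qF j = vd i ^ (- a i j) *: (qF j * qK i).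
Proof.
rewrite -[LHS]qpiM -[qF j * _]qpiM -[RHS]qpiZ.
by apply: qpi_eq; apply: rel_KF.
Qed.

Lemma qE_F i j : i != j -> qE i * qF j = qF j * qE i.
Proof.
move=> ij; rewrite -[LHS]qpiM -[RHS]qpiM.
by apply: qpi_eq; apply: rel_EF.
Qed.

Lemma qE_F_same i :
  qE i * qF i - qF i * qE i = (vd i - (vd i)^-1)^-1 *: (qK i - qKV i).
Proof.
have qpiB x y : qpi (qgroup_rel a d) (x - y) = qpi _ x - qpi _ y.
  by apply: (addIr (qpi _ y)); rewrite -qpiD !addrNK.
have E : qpi (qgroup_rel a d) (fE i * fF i - fF i * fE i)
    = qpi _ ((vd i - (vd i)^-1)^-1 *: (fK i - fKV i)).
  by apply: qpi_eq; apply: rel_EFii.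
by move: E; rewrite qpiZ !qpiB !qpiM.
Qed.

Lemma qKV_comm i (x : UQ) (e : int) :
  qK i * x = vd i ^ e *: (x * qK i) -> qKV i * x = vd i ^ (- e) *: (x * qKV i).
Proof.
move=> Kx.
have : qKV i * (qK i * x) * qKV i
    = qKV i * (vd i ^ e *: (x * qK i)) * qKV i by rewrite Kx.
rewrite mulrA qKV_K mul1r -scalerAr -scalerAl -!mulrA qK_KV mulr1 => ->.
by rewrite scalerA -expfzDr ?vd_neq0 // addNr expr0z scale1r.
Qed.

Lemma q_comm_pow i (x : UQ) (e : int) b :
  qK i * x = vd i ^ e *: (x * qK i) ->
  qK i * x ^+ b = vd i ^ (e * b%:Z) *: (x ^+ b * qK i).
Proof.
move=> Kx; elim: b => [|b IH].
  by rewrite mulr0 expr0z scale1r mulr1 mul1r.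
rewrite exprS mulrA Kx -scalerAl -(mulrA x (qK i)) IH -scalerAr scalerA.
rewrite -expfzDr ?vd_neq0 //.
by rewrite !mulrA; congr (vd i ^ _ *: _); rewrite -(addn1 b) PoszD; ring.
Qed.

Lemma divE0 i : divE a d i 0 = 1. Proof. exact: divpow0. Qed.
Lemma divF0 i : divF a d i 0 = 1. Proof. exact: divpow0. Qed.

Lemma qK_divE i j b :
  qK i * divE a d j b = vd i ^ (a i j * b%:Z) *: (divE a d j b * qK i).
Proof.
by rewrite /divE -scalerAr -scalerAl (q_comm_pow b (qK_E i j)) !scalerA mulrC.
Qed.

Lemma qK_divF i j b :
  qK i * divF a d j b = vd i ^ (- a i j * b%:Z) *: (divF a d j b * qK i).
Proof.
by rewrite /divF -scalerAr -scalerAl (q_comm_pow b (qK_F i j)) !scalerA mulrC.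
Qed.

Lemma divE_divF i j b c :
  i != j -> divE a d i b * divF a d j c = divF a d j c * divE a d i b.
Proof.
move=> ij; rewrite /divE /divF -!scalerAl -!scalerAr !scalerA mulrC.
congr (_ *: _); apply: commrX; apply: commr_sym; apply: commrX.
by apply: commr_sym; apply: qE_F.
Qed.

Definition kbinU i (c : int) (t : nat) : UQ := kbin (vd i) (qK i) (qKV i) c t.

Lemma Kbin_kbinU i m : Kbin a d i m = kbinU i 0 m.
Proof.
rewrite /Kbin /kbinU /kbin big_add1 big_mkord; apply: eq_bigr => s _.
by congr (_ *: (vd i ^ _ *: _ - vd i ^ _ *: _)); rewrite -(addn1 s) PoszD; ring.
Qed.

Lemma int_shift_ind (P : int -> Prop) :
  P 0 -> (forall c, P c -> P (c + 1)) -> (forall c, P (c + 1) -> P c) ->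
  forall c, P c.
Proof.
move=> P0 Pup Pdown; elim/int_rect => // m Pm.
  by rewrite -addn1 PoszD; apply: Pup.
by apply: Pdown; rewrite -addn1 PoszD opprD addrNK.
Qed.

Lemma laurent_vd i z : vd i ^ z \in laurent.
Proof.
have vl : vq \in laurent.
  apply/asboolP; exists 'X, 0%N.
  by rewrite /lpoly map_polyX hornerX expr0 divr1.
have vVl : vq^-1 \in laurent.
  by apply/asboolP; exists 1, 1%N; rewrite /lpoly rmorph1 hornerC expr1 mul1r.
case: z => m; first by rewrite -exprnP rpredX // rpredX.
by rewrite NegzE -exprnN -!exprVn rpredX // rpredX.
Qed.

Lemma qbin_pascal_down i m t :
  qbin (vd i) m t.+1 = vd i ^ (- t.+1%:Z) * (qbin (vd i) (m + 1) t.+1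
    - vd i ^ (t%:Z - m) * qbin (vd i) m t).
Proof.
rewrite !qbinE gbin_pascal ?vd_neq0 //; last exact: vd_gen.
by rewrite addrK mulrA -expfzDr ?vd_neq0 // addNr expr0z mul1r.
Qed.

Lemma laurent_qbin i t m : qbin (vd i) m t \in laurent.
Proof.
elim: t m => [|t IH] m; first by rewrite qbinE gbin0 rpred1.
elim/int_shift_ind: m => [|m Lm|m Lm].
- rewrite /qbin big_ord_recl subr0 /qint oppr0 subrr.
  by rewrite mul0r mul0r mul0r rpred0.
- rewrite qbinE (gbin_pascal (vd_neq0 i) (vd_gen i)).
  by rewrite rpredD // rpredM // laurent_vd.
- rewrite qbin_pascal_down; apply: rpredM; first exact: laurent_vd.
  by apply: rpredB => //; apply: rpredM; [apply: laurent_vd | apply: IH].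
Qed.

Lemma kbinU_pascal i c t :
  kbinU i (c + 1) t.+1 = vd i ^ t.+1%:Z *: kbinU i c t.+1
    + vd i ^ (t%:Z - c) *: (qKV i * kbinU i c t).
Proof.
exact: (kbin_pascal (vd_neq0 i) (vd_gen i) (qK_KV i) (qKV_K i)).
Qed.

Lemma kbinU_pascal_down i c t :
  kbinU i c t.+1 = vd i ^ (- t.+1%:Z) *: (kbinU i (c + 1) t.+1
    - vd i ^ (t%:Z - c) *: (qKV i * kbinU i c t)).
Proof.
rewrite kbinU_pascal addrK scalerA -expfzDr ?vd_neq0 // addNr expr0z.
by rewrite scale1r.
Qed.

Definition vZ i z : Zv := MkZv (laurent_vd i z).
Definition qbinZ i m t : Zv := MkZv (laurent_qbin i t m).

Lemma UZ_predZ i z x : x \in UZ_pred -> vd i ^ z *: x \in UZ_pred.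
Proof. by move=> /asboolP Ux; apply/asboolP/(ZsubalgZ (vZ i z)). Qed.

Lemma UZ_divE i b : divE a d i b \in UZ_pred.
Proof. by apply/asboolP/Zsubalg_gen/UZ_gen_E. Qed.
Lemma UZ_divF i b : divF a d i b \in UZ_pred.
Proof. by apply/asboolP/Zsubalg_gen/UZ_gen_F. Qed.
Lemma UZ_K i : qK i \in UZ_pred.
Proof. by apply/asboolP/Zsubalg_gen/UZ_gen_K. Qed.
Lemma UZ_KV i : qKV i \in UZ_pred.
Proof. by apply/asboolP/Zsubalg_gen/UZ_gen_KV. Qed.

Lemma divE_divF_same i b c : divE a d i b * divF a d i c =
  \sum_(t < b.+1 | (t <= c)%N)
     divF a d i (c - t) * kbinU i (t%:Z * 2 - b%:Z - c%:Z) t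
       * divE a d i (b - t).
Proof.
have KF := qK_F i i; have KE := qK_E i i; rewrite a_diag in KF KE.
apply: (divpow_comm (vd_neq0 i) (vd_gen i) (qK_KV i) (qKV_K i)) => //.
- exact: qKV_comm.
- exact: qKV_comm.
- exact: qE_F_same.
Qed.

(** [K; c over t] is the last term of the commutation rule for [E^(t) F^(t)],
    and the other terms involve smaller binomials only; Pascal's rule then moves
    the shift [c] away from 0. *)
Lemma UZ_kbinU i c t : kbinU i c t \in UZ_pred.
Proof.
have [k] := ubnP t; elim: k t c => // k IH [|t] c; rewrite ltnS => tk.
  by rewrite /kbinU kbin0 rpred1.
elim/int_shift_ind: c => [|c Uc|c Uc].
- have := divE_divF_same i t.+1 t.+1; rewrite big_mkcond big_ord_recr /= leqnn.
  rewrite subnn divE0 divF0 mul1r mulr1.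
  rewrite (_ : _ - _ - _ = 0); last by ring.
  rewrite [X in _ = X]addrC => /esym/(canRL (addrK _)) ->; apply: rpredB.
    by apply: rpredM; [apply: UZ_divE | apply: UZ_divF].
  apply: rpred_sum => u _; rewrite ltnW //=.
  apply: rpredM; last exact: UZ_divE.
  by apply: rpredM; [apply: UZ_divF | apply: IH; apply: leq_trans tk].
- rewrite kbinU_pascal; apply: rpredD; apply: UZ_predZ => //.
  by apply: rpredM; [apply: UZ_KV | apply: IH].
- rewrite kbinU_pascal_down; apply/UZ_predZ/rpredB => //; apply/UZ_predZ.
  by apply: rpredM; [apply: UZ_KV | apply: IH].
Qed.

(** The character of a weight is given on [K; 0 over t]; the value on
    [K; c over t] follows since both sides satisfy Pascal's rule. *)
Lemma weight_char_kbinU m i c t :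
  weight_char m (kbinU i c t) (qbin (vd i) (m i + c) t).
Proof.
have WZ z x y : weight_char m x y ->
    weight_char m (vd i ^ z *: x) (vd i ^ z * y).
  by move=> xy; apply: (charZ (vZ i z)).
have WB x y x' y' : weight_char m x y -> weight_char m x' y' ->
    weight_char m (x - x') (y - y').
  move=> xy xy'; apply: charD => //; have := charZ (-1) xy'.
  by rewrite -[zval _]/(val (-1 : Zv)) rmorphN rmorph1 scaleN1r mulN1r.
have WKV c' x y z : weight_char m x y ->
    weight_char m (vd i ^ (z - c') *: (qKV i * x))
      (vd i ^ (z - (m i + c')) * y).
  have -> : z - (m i + c') = z - c' + - m i by ring.
  move=> xy; rewrite (expfzDr (z - c')) ?vd_neq0 // -mulrA; apply: WZ.
  by apply: charM => //; apply/char_gen/weight_gen_KV.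
elim: t c => [|t IH] c; first by rewrite /kbinU kbin0 qbinE gbin0; apply: char1.
elim/int_shift_ind: c => [|c Wc|c Wc].
- by rewrite -Kbin_kbinU addr0; apply/char_gen/weight_gen_Kbin.
- rewrite addrA kbinU_pascal qbinE (gbin_pascal (vd_neq0 i) (vd_gen i)).
  by apply: charD; [apply: WZ | apply: WKV].
- rewrite kbinU_pascal_down qbin_pascal_down; apply/WZ/WB/WKV; last exact: IH.
  by rewrite -addrA.
Qed.

Definition divEZ i b : UZ a d := MkUZ (UZ_divE i b).
Definition divFZ i b : UZ a d := MkUZ (UZ_divF i b).
Definition KZ i : UZ a d := MkUZ (UZ_K i).
Definition KVZ i : UZ a d := MkUZ (UZ_KV i).
Definition kbinZ i c t : UZ a d := MkUZ (UZ_kbinU i c t).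
End Generators.

Section SpecOne.
Variables (n : nat) (d : 'I_n -> nat) (k : fieldType).
Hypothesis d_gt0 : forall i, (0 < d i)%N.
Local Notation spec1 := (spec (oner_neq0 k)).

Lemma spec1_vZ i z : spec1 (vZ d i z) = 1.
Proof.
case: z => m.
  have E : zval (vZ d i m) = lpoly vq 'X^(d i * m) 0.
    by rewrite /lpoly map_polyXn hornerXn expr0 divr1 exprM.
  by rewrite (specE _ E) /lpoly map_polyXn hornerXn !expr1n divr1.
have E : zval (vZ d i (Negz m)) = lpoly vq 1 (d i * m.+1).
  by rewrite /lpoly rmorph1 hornerC mul1r exprM.
by rewrite (specE _ E) /lpoly rmorph1 hornerC expr1n divr1.
Qed.

(** The ordinary binomial coefficient of [m] over [t], as an element of [k]. *)
Definition spec_bin i m t : k := spec1 (qbinZ d_gt0 i m t).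

Lemma spec_bin0 i m : spec_bin i m 0 = 1.
Proof.
rewrite /spec_bin -[RHS](rmorph1 spec1); congr spec; apply: val_inj.
exact: gbin0.
Qed.

Lemma spec_bin_pascal i m t :
  spec_bin i (m + 1) t.+1 = spec_bin i m t.+1 + spec_bin i m t.
Proof.
rewrite /spec_bin (_ : qbinZ _ _ _ _ = vZ d i t.+1%:Z * qbinZ d_gt0 i m t.+1
   + vZ d i (t%:Z - m) * qbinZ d_gt0 i m t); last first.
  by apply: val_inj; apply: (gbin_pascal (vd_neq0 d i) (vd_gen d_gt0 i)).
by rewrite rmorphD !rmorphM /= !spec1_vZ !mul1r.
Qed.
End SpecOne.

(** Pascal's rule alone gives the congruences of binomial coefficients used
    below, for negative [m] as well. *)
Section PascalFunction.
Variables (k : fieldType) (B : int -> nat -> k).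
Hypothesis B0 : forall m, B m 0 = 1.
Hypothesis BS : forall m t, B (m + 1) t.+1 = B m t.+1 + B m t.

Lemma pascal_vandermonde m N t :
  B (m + N%:Z) t = \sum_(j < t.+1) B m (t - j) *+ 'C(N, j).
Proof.
elim: N t => [|N IH] t.
  by rewrite addr0 big_ord_recl /= subn0 bin0 big1 ?addr0.
rewrite -(addn1 N) PoszD addrA addn1; case: t => [|t].
  by rewrite big_ord1 !B0 bin0.
rewrite BS !IH [in LHS]big_ord_recl [RHS]big_ord_recl !bin0 -addrA.
congr (_ + _); rewrite -big_split; apply: eq_bigr => j _ /=.
by rewrite /bump leq0n add1n subSS binS mulrnDr.
Qed.

Variable p : nat.
Hypothesis charp : p \in [pchar k].

Lemma bin_pexp_eq0 s j : (0 < j < p ^ s)%N -> 'C(p ^ s, j)%:R = 0 :> k.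
Proof.
have pr : prime p := pcharf_prime charp.
case: j => // j /= js; apply/eqP; rewrite -(dvdn_pcharf charp).
apply/negPn/negP => pC; suff : (p ^ s %| j.+1)%N by apply/negP; rewrite gtnNdvd.
rewrite -(@Gauss_dvdl _ _ 'C(p ^ s, j.+1)) ?coprimeXl ?prime_coprime //.
by rewrite -mul_bin_diag dvdn_mulr.
Qed.

(** By Vandermonde, as the binomials of [p^s] over [j] vanish for
    [0 < j < p^s]. *)
Lemma pascal_periodic m t s : (t < p ^ s)%N -> B (m + (p ^ s)%:Z) t = B m t.
Proof.
move=> ts; rewrite pascal_vandermonde big_ord_recl bin0 subn0 mulr1n.
rewrite big1 ?addr0 // => j _; rewrite -mulr_natr bin_pexp_eq0 ?mulr0 //=.
exact: leq_ltn_trans ts.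
Qed.

Lemma pascal_periodicZ m t s (u : int) : (t < p ^ s)%N ->
  B (m + u * (p ^ s)%:Z) t = B m t.
Proof.
move=> ts; elim/int_shift_ind: u => [|u <-|u].
- by rewrite mul0r addr0.
- by rewrite mulrDl mul1r addrA pascal_periodic.
- by rewrite mulrDl mul1r addrA pascal_periodic.
Qed.

Lemma pascal_pexp m s u :
  B (m + u%:Z * (p ^ s)%:Z) (p ^ s) = B m (p ^ s) + u%:R.
Proof.
have ps : (0 < p ^ s)%N by rewrite expn_gt0 prime_gt0 // (pcharf_prime charp).
elim: u => [|u IH]; first by rewrite mul0r !addr0.
rewrite -(addn1 u) PoszD mulrDl mul1r addrA natrD addrA -IH.
move: (m + _) => m'; rewrite pascal_vandermonde.
rewrite big_ord_recl bin0 subn0 mulr1n; congr (_ + _).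
case: (p ^ s)%N ps (bin_pexp_eq0 (s := s)) => // q _ bq.
rewrite big_ord_recr /= subnn B0 binn mulr1n big1 ?add0r // => j _.
by rewrite -mulr_natr bq ?mulr0 //= /bump leq0n add1n ltnS.
Qed.

(** If [m' - m = p^s u] with [p] not dividing [u], the two integers are already
    told apart by the binomials over [p^s], whose values differ by [u]. *)
Lemma pascal_separates m m' : (forall t, B m t = B m' t) -> m = m'.
Proof.
have pr : prime p := pcharf_prime charp.
wlog le : m m' / m <= m'.
  move=> wl; case: (leP m m') => [le|/ltW le] E; first exact: wl.
  by apply/esym/wl.
move=> E; have [//|ne] := eqVneq m m'.
have [N NE] : exists N : nat, m' = m + N%:Z.
  by exists `|m' - m|%N; rewrite gez0_abs ?subr_ge0 // [RHS]addrC subrK.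
have N0 : (0 < N)%N.
  by rewrite lt0n; apply: contraNneq ne => N0; rewrite NE N0 addr0.
have [u pu uE] : exists2 u, ~~ (p %| u)%N & N = (u * p ^ logn p N)%N.
  case/(pfactor_coprime pr): N0 => u pu uE.
  by exists u; rewrite -?prime_coprime.
have := pascal_pexp m (logn p N) u.
rewrite -PoszM -uE -NE -E -[LHS]addr0 => /addrI/esym/eqP.
by rewrite -(dvdn_pcharf charp) (negPf pu).
Qed.
End PascalFunction.

(** * Weight vectors at q = 1 *)

Section Restriction.
Variables (n : nat) (a : 'I_n -> 'I_n -> int) (d : 'I_n -> nat) (k : fieldType).
Local Notation UK := (UK a d (oner_neq0 k)).
Local Notation UZ := (UZ a d).
Local Notation spec1 := (spec (oner_neq0 k)).
Local Notation uk := (@uk n a d k 1 (oner_neq0 k)).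

Lemma ukD X Y c : uk (X + Y) c = uk X c + uk Y c. Proof. exact: bcDl. Qed.
Lemma ukM X Y c c' : uk (X * Y) (c * c') = uk X c * uk Y c'.
Proof. exact: bcM. Qed.
Lemma ukZ z X c : uk (z *: X) c = uk X (spec1 z * c). Proof. exact: bcZ. Qed.
Lemma uk_scale c X c' : c *: uk X c' = uk X (c * c').
Proof. exact: bc_scaleE. Qed.

(** A [U_K]-module seen as a vector space over the base field. *)
Definition vspace_of (L : lmodType UK) : Type := L.
Section Vspace.
Variable L : lmodType UK.
HB.instance Definition _ := GRing.Zmodule.on (vspace_of L).

Definition vscale (c : k) (x : vspace_of L) : vspace_of L :=
  ((c%:A : UK) *: (x : L) : L).

Fact vscaleA c c' x : vscale c (vscale c' x) = vscale (c * c') x.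
Proof. by rewrite /vscale [LHS]scalerA -scalerAl mul1r scalerA. Qed.
Fact vscale1 : left_id 1 vscale.
Proof. by move=> x; rewrite /vscale !scale1r. Qed.
Fact vscaleDr : right_distributive vscale +%R.
Proof. by move=> c x y; rewrite /vscale [LHS]scalerDr. Qed.
Fact vscaleDl x : {morph vscale^~ x : c c' / c + c'}.
Proof. by move=> c c'; rewrite /vscale !scalerDl. Qed.
HB.instance Definition _ := GRing.Zmodule_isLmodule.Build k (vspace_of L)
  vscaleA vscale1 vscaleDr vscaleDl.

Lemma vscaleE c (x : vspace_of L) : c *: x = ((c%:A : UK) *: (x : L) : L).
Proof. by []. Qed.

(** Elements of [U_K] are sums of multiples of [X] with [X] in [U_Z], so the
    action of [U_Z] determines the module. *)
Definition act (X : UZ) (x : vspace_of L) : vspace_of L :=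
  (uk X 1 *: (x : L) : L).

Lemma uk_act X c (x : L) : uk X c *: x = c *: act X (x : vspace_of L).
Proof.
rewrite vscaleE /act [RHS]scalerA; congr (_ *: _).
by rewrite -scalerAl mul1r uk_scale mulr1.
Qed.

Lemma actM X Y x : act (X * Y) x = act X (act Y x).
Proof. by rewrite /act [RHS]scalerA -ukM mulr1. Qed.
Lemma actD X Y x : act (X + Y) x = act X x + act Y x.
Proof. by rewrite /act ukD [LHS]scalerDl. Qed.
Lemma act1 x : act 1 x = x.
Proof. by rewrite /act (_ : uk 1 1 = 1) ?[LHS]scale1r. Qed.
Lemma actZ z X x : act (z *: X) x = spec1 z *: act X x.
Proof. by rewrite /act ukZ mulr1 -/(act _ _) -uk_act. Qed.
Fact act_linear X : linear (act X).
Proof.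
move=> c x y; rewrite /act [LHS]scalerDr; congr (_ + _).
rewrite !vscaleE [LHS]scalerA [RHS]scalerA.
have -> // : uk X 1 * c%:A = c%:A * uk X 1.
by rewrite -scalerAl mul1r -scalerAr mulr1.
Qed.
HB.instance Definition _ X :=
  GRing.isLinear.Build k (vspace_of L) (vspace_of L) _ (act X) (act_linear X).

Lemma act0 x : act 0 x = 0.
Proof. by apply: (addrI (act 0 x)); rewrite -actD !addr0. Qed.
Lemma act_sum I r (P : pred I) (F : I -> UZ) x :
  act (\sum_(i <- r | P i) F i) x = \sum_(i <- r | P i) act (F i) x.
Proof. exact: (big_morph (act^~ x) (fun X Y => actD X Y x) (act0 x)). Qed.

End Vspace.
End Restriction.

Section WeightVectors.
Variables (n : nat) (a : 'I_n -> 'I_n -> int) (d : 'I_n -> nat) (k : fieldType).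
Hypothesis d_gt0 : forall i, (0 < d i)%N.
Hypothesis a_diag : forall i, a i i = 2.
Local Notation UK := (UK a d (oner_neq0 k)).
Local Notation UZ := (UZ a d).
Local Notation spec1 := (spec (oner_neq0 k)).
Local Notation uk := (@uk n a d k 1 (oner_neq0 k)).
Local Notation B := (spec_bin k d_gt0).
Variable L : lmodType UK.
Local Notation V := (vspace_of L).

Definition opE i b : V -> V := act (divEZ a d i b).
Definition opF i b : V -> V := act (divFZ a d i b).
Definition opK i : V -> V := act (KZ a d i).
Definition opKV i : V -> V := act (KVZ a d i).
Definition opB i c t : V -> V := act (kbinZ d_gt0 a_diag i c t).

HB.instance Definition _ i b := GRing.Linear.on (opE i b).
HB.instance Definition _ i b := GRing.Linear.on (opF i b).
HB.instance Definition _ i := GRing.Linear.on (opK i).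
HB.instance Definition _ i := GRing.Linear.on (opKV i).
HB.instance Definition _ i c t := GRing.Linear.on (opB i c t).

Definition wt (m : 'I_n -> int) (x : V) : Prop := weight_space (M := L) m x.

Lemma wt_act m x (H : UZ) (z : Zv) :
  wt m x -> weight_char m (uzval H) (zval z) -> act H x = spec1 z *: x.
Proof.
by move=> wx Hz; have := wx H z 1 Hz; rewrite uk_act scale1r mulr1 -vscaleE.
Qed.

Lemma wt_K m x i : wt m x -> opK i x = x.
Proof.
move=> wx; rewrite /opK (wt_act (z := vZ d i (m i)) wx).
  by rewrite spec1_vZ scale1r.
exact/char_gen/weight_gen_K.
Qed.

Lemma wt_KV m x i : wt m x -> opKV i x = x.
Proof.
move=> wx; rewrite /opKV (wt_act (z := vZ d i (- m i)) wx).
  by rewrite spec1_vZ scale1r.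
exact/char_gen/weight_gen_KV.
Qed.

Lemma wt_B m x i c t : wt m x -> opB i c t x = B i (m i + c) t *: x.
Proof. by move=> wx; apply: (wt_act wx); apply: weight_char_kbinU. Qed.

(** At q = 1 the torus elements themselves act trivially on weight vectors, and
    a weight is seen through its binomials only. *)
Lemma wt_intro m x : (forall i, opK i x = x) -> (forall i, opKV i x = x) ->
  (forall i t, opB i 0 t x = B i (m i) t *: x) -> wt m x.
Proof.
move=> Kx KVx Bx H z c Hz; rewrite uk_act -vscaleE.
rewrite -scalerA scalerA mulrC -scalerA; congr (_ *: _).
suff [H' [z' [/val_inj <- /val_inj <- //]]]: exists (H' : UZ) (z' : Zv),
    [/\ uzval H' = uzval H, zval z' = zval z & act H' x = spec1 z' *: x].
move: (uzval H) (zval z) Hz => {H z} h0 y0.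
elim=> {h0 y0} [_ _ [i|i|i t]||h y h' y' _ [H [z [<- <- E]]] _ [H' [z' [<- <- E']]]
    |h y h' y' _ [H [z [<- <- E]]] _ [H' [z' [<- <- E']]]
    |z h y _ [H [z' [<- <- E]]]].
- exists (KZ a d i), (vZ d i (m i)); split=> //.
  by rewrite spec1_vZ scale1r; apply: Kx.
- exists (KVZ a d i), (vZ d i (- m i)); split=> //.
  by rewrite spec1_vZ scale1r; apply: KVx.
- exists (kbinZ d_gt0 a_diag i 0 t), (qbinZ d_gt0 i (m i) t).
  by split=> //; [rewrite Kbin_kbinU | apply: Bx].
- by exists 1, 1; split=> //; rewrite act1 rmorph1 scale1r.
- by exists (H + H'), (z + z'); split=> //; rewrite actD E E' rmorphD scalerDl.
- exists (H * H'), (z * z'); split=> //.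
  by rewrite actM E' linearZ /= E scalerA rmorphM mulrC.
- exists (z *: H), (z * z'); split=> //.
  by rewrite actZ E scalerA rmorphM.
Qed.

Lemma opE0 i x : opE i 0 x = x.
Proof.
by rewrite -[RHS]act1 /opE; congr (act _ x); apply: val_inj; apply: divE0.
Qed.

Lemma opF0 i x : opF i 0 x = x.
Proof.
by rewrite -[RHS]act1 /opF; congr (act _ x); apply: val_inj; apply: divF0.
Qed.

Lemma opE_opF i j b c x : i != j -> opE i b (opF j c x) = opF j c (opE i b x).
Proof.
move=> ij; rewrite /opE /opF -!actM; congr (act _ x); apply: val_inj.
exact: divE_divF.
Qed.

(** Elements of [U_Z] commuting up to a power of v commute at q = 1. *)
Lemma act_qcomm i (X Y : UZ) (e : int) (x : V) :
  uzval Y * uzval X = vd d i ^ e *: (uzval X * uzval Y) ->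
  act Y (act X x) = act X (act Y x).
Proof.
move=> YX; have E : Y * X = vZ d i e *: (X * Y) by apply: val_inj.
by rewrite -!actM E actZ spec1_vZ scale1r.
Qed.

Lemma wt_act_shift m m' (X : UZ) x :
  (forall j, qK a d j * uzval X
     = vd d j ^ (m' j - m j) *: (uzval X * qK a d j)) ->
  wt m x -> wt m' (act X x).
Proof.
move=> KX wx; have KVX j := qKV_comm (KX j).
apply: wt_intro => [j|j|j t].
- by rewrite /opK (@act_qcomm j X (KZ a d j) _ x (KX j)) [X in act _ X](wt_K _ wx).
- rewrite /opKV (@act_qcomm j X (KVZ a d j) _ x (KVX j)).
  by rewrite [X in act _ X](wt_KV _ wx).
- have E : kbinZ d_gt0 a_diag j 0 t * X
      = X * kbinZ d_gt0 a_diag j (0 + (m' j - m j)) t.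
    by apply: val_inj; apply: (kbin_mul (vd_neq0 d j) (KX j) (KVX j)).
  rewrite /opB -actM E actM [X in act _ X](wt_B _ _ _ wx) linearZ /=.
  by rewrite add0r addrC subrK.
Qed.

Lemma wt_E m i b x : wt m x -> wt (fun j => m j + a j i * b%:Z) (opE i b x).
Proof.
apply: wt_act_shift => j; rewrite [m j + _]addrC addrK; exact: qK_divE.
Qed.

Lemma wt_F m i b x : wt m x -> wt (fun j => m j - a j i * b%:Z) (opF i b x).
Proof.
apply: wt_act_shift => j; rewrite [m j - _]addrC addrK -mulNr; exact: qK_divF.
Qed.

(** [K; 2t-b-c over t] acts on a vector of weight [m i + 2(b-t)] as the binomial
    of [m i + b - c] over [t]. *)
Lemma opE_opF_same m i b c x : wt m x -> opE i b (opF i c x) =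
  \sum_(t < b.+1 | (t <= c)%N)
     B i (m i + b%:Z - c%:Z) t *: opF i (c - t) (opE i (b - t) x).
Proof.
move=> wx.
have E : divEZ a d i b * divFZ a d i c = \sum_(t < b.+1 | (t <= c)%N)
   divFZ a d i (c - t) * kbinZ d_gt0 a_diag i (t%:Z * 2 - b%:Z - c%:Z) t
     * divEZ a d i (b - t).
  apply: val_inj; rewrite rmorph_sum; exact: divE_divF_same.
rewrite /opE /opF -actM E act_sum; apply: eq_bigr => t _.
rewrite !actM -/(opE _ _ _) -/(opB _ _ _ _).
rewrite (wt_B _ _ _ (@wt_E _ i (b - t) _ wx)) linearZ /= a_diag.
congr (B i _ t *: _).
by rewrite -subzn -1?ltnS //; ring.
Qed.

Lemma wt_sum_closed m c x y : wt m x -> wt m y -> wt m (c *: x + y).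
Proof.
move=> wx wy; apply: wt_intro => [i|i|i t].
- by rewrite linearP /= !(wt_K i wx, wt_K i wy).
- by rewrite linearP /= !(wt_KV i wx, wt_KV i wy).
- rewrite linearP /= !(wt_B _ _ _ wx, wt_B _ _ _ wy) addr0.
  by rewrite scalerDr !scalerA mulrC.
Qed.

Lemma wt0 m : wt m 0.
Proof. by move=> H z c _; rewrite [LHS]scaler0 [RHS]scaler0. Qed.
End WeightVectors.

Section IrreducibleQuotient.
Variables (n : nat) (a : 'I_n -> 'I_n -> int) (d : 'I_n -> nat) (k : fieldType).
Hypothesis d_gt0 : forall i, (0 < d i)%N.
Hypothesis a_diag : forall i, a i i = 2.
Local Notation q0 := (oner_neq0 k).
Local Notation UK := (UK a d q0).
Local Notation UZ := (UZ a d).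
Local Notation uk := (@uk n a d k 1 q0).
Variable L : lmodType UK.
Local Notation V := (vspace_of L).

Section Stable.
Variable S : V -> Prop.
Hypothesis S0 : S 0.
Hypothesis Slin : forall c x y, S x -> S y -> S (c *: x + y).
Hypothesis SE : forall i b x, S x -> S (opE i b x).
Hypothesis SF : forall i b x, S x -> S (opF i b x).
Hypothesis SK : forall i x, S x -> S (opK i x).
Hypothesis SKV : forall i x, S x -> S (opKV i x).

Lemma stable_scale c x : S x -> S (c *: x).
Proof. by move=> Sx; rewrite -[_ *: x]addr0; apply: Slin. Qed.

Lemma stable_add x y : S x -> S y -> S (x + y).
Proof. by move=> Sx Sy; rewrite -[x]scale1r; apply: Slin. Qed.

Lemma stable_act (X : UZ) x : S x -> S (act X x).
Proof.
case: X => X UX; have /asboolP := UX.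
suff gen h : Zsubalg (@UZ_gen n a d) h ->
    exists2 Y : UZ, uzval Y = h & forall x, S x -> S (act Y x).
  case/gen=> Y YX SY Sx.
  by rewrite (_ : MkUZ UX = Y); [apply: SY | apply: val_inj].
elim=> {X UX x h} [_ [i m|i m|i|i]||h h' _ [X <- SX] _ [Y <- SY]
    |h h' _ [X <- SX] _ [Y <- SY]|z h _ [X <- SX]].
- by exists (divEZ a d i m) => // x; apply: SE.
- by exists (divFZ a d i m) => // x; apply: SF.
- by exists (KZ a d i) => // x; apply: SK.
- by exists (KVZ a d i) => // x; apply: SKV.
- by exists 1 => // x Sx; rewrite act1.
- by exists (X + Y) => // x Sx; rewrite actD; apply: stable_add; auto.
- by exists (X * Y) => // x Sx; rewrite actM; auto.
- by exists (z *: X) => // x Sx; rewrite actZ; apply: stable_scale; auto.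
Qed.

Lemma stable_UK (u : UK) (x : L) : S x -> S (u *: x : L).
Proof.
move=> Sx; elim/bc_ind: u => [|u u' Su Su'|X c].
- by rewrite [_ *: _](scale0r x).
- by rewrite [_ *: _](scalerDl x); apply: stable_add.
- by rewrite -[bc _ _ _]/(uk X c) uk_act; apply/stable_scale/stable_act.
Qed.
End Stable.

Variable lam : 'I_n -> int.
Hypothesis hL : irreducible_quotient (verma a d q0 lam) L.

Lemma verma_scale (u u' : UK) c :
  u *: verma_pure lam u' c = verma_pure lam (u * u') c.
Proof. exact: verma_actE. Qed.

Let vpure : UK -> k -> verma a d q0 lam := verma_pure lam.

Lemma verma_bal u (H : UZ) (z : Zv) c c' : borel_char lam (uzval H) (zval z) ->
  vpure (u * uk H c) c' = vpure u (spec q0 z * c * c').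
Proof. by move=> Hz; apply: (pure_bal _ _ u (BorelElt c Hz) c'). Qed.

Lemma verma_scal u c c' : vpure (u * uk 1 c) c' = vpure u (c * c').
Proof.
rewrite (@verma_bal _ _ 1) ?rmorph1 ?mul1r //.
exact: (char1 (borel_gen lam)).
Qed.

Lemma verma_borel (H : UZ) (z : Zv) c : borel_char lam (uzval H) (zval z) ->
  uk H c *: vpure 1 1 = (spec q0 z * c)%:A *: vpure 1 1.
Proof.
move=> Hz; rewrite [LHS]verma_scale [RHS]verma_scale uk_scale !mulr1.
rewrite -[uk H c]mul1r -[uk 1 _]mul1r [LHS](verma_bal _ _ _ Hz).
exact/esym/verma_scal.
Qed.

(** The image of [1 (x) 1]. *)
Lemma highest_weight_vector : exists v : V, [/\ wt lam v,
  forall i b, (0 < b)%N -> opE i b v = 0, v != 0 &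
  forall y : L, exists u : UK, y = u *: (v : L)].
Proof.
case: hL => [[[y0 y0n0] _] [pi pi_onto]].
pose v : L := pi (vpure 1 1).
have gen (y : L) : exists u : UK, y = u *: v.
  have [x <-] := pi_onto y; elim/verma_ind: x => [|x x' [u E] [u' E']|u c].
  - by exists 0; rewrite linear0 scale0r.
  - by exists (u + u'); rewrite linearD E E' scalerDl.
  exists (u * uk 1 c); rewrite -linearZ; congr (pi _).
  by rewrite [RHS]verma_scale mulr1 [RHS]verma_scal mulr1.
exists v; split => //.
- move=> H z c Hz; rewrite /v -!linearZ (@verma_borel H z c) //.
  by apply: char_gen; apply: borel_gen_U0.
- move=> i b b0; rewrite /opE /act /v -linearZ (@verma_borel _ 0 1).
    by rewrite rmorph0 mul0r scale0r scale0r linear0.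
  by apply: char_gen; apply: borel_gen_E.
- apply/eqP => v0; move: y0n0; have [u ->] := gen y0.
  by rewrite v0 scaler0 eqxx.
Qed.
End IrreducibleQuotient.

(** * Bases of subspaces *)

Section FiniteDimension.
Variables (k : fieldType) (V : lmodType k).

Definition lin_closed (W : V -> Prop) : Prop :=
  W 0 /\ forall c x y, W x -> W y -> W (c *: x + y).

Fixpoint spanned (s : seq V) (x : V) : Prop :=
  if s is z :: s' then exists c y, spanned s' y /\ x = c *: z + y else x = 0.

Definition is_basis (W : V -> Prop) N (b : 'I_N -> V) : Prop :=
  (forall i, W (b i)) /\
  forall x, W x -> exists! c : {ffun 'I_N -> k}, x = \sum_i c i *: b i.

Lemma spanned_lin s : lin_closed (spanned s).
Proof.
elim: s => [|z s [IH0 IH]]; split=> //=.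
- by move=> c x y -> ->; rewrite scaler0 addr0.
- by exists 0, 0; rewrite scale0r addr0.
- move=> c _ _ [c1 [x [Sx ->]]] [c2 [y [Sy ->]]].
  exists (c * c1 + c2), (c *: x + y); split; first exact: IH.
  by rewrite scalerDr scalerA scalerDl addrACA.
Qed.

Section Closed.
Variable W : V -> Prop.
Hypothesis W_lin : lin_closed W.

Lemma lin_closedD x y : W x -> W y -> W (x + y).
Proof. by move=> Wx Wy; rewrite -[x]scale1r; apply: W_lin.2. Qed.

Lemma lin_closedZ c x : W x -> W (c *: x).
Proof.
by move=> Wx; rewrite -[_ *: _]addr0; apply: W_lin.2 => //; apply: W_lin.1.
Qed.

Lemma lin_closedB x y : W x -> W y -> W (x - y).
Proof. by move=> Wx Wy; rewrite addrC -scaleN1r; apply: W_lin.2. Qed.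

Lemma lin_closed_sum I (r : seq I) (P : pred I) (f : I -> V) :
  (forall i, P i -> W (f i)) -> W (\sum_(i <- r | P i) f i).
Proof.
by move=> Wf; elim/big_ind: _ => //; [apply: W_lin.1 | apply: lin_closedD].
Qed.
End Closed.

Lemma spanned_in s : forall i, (i < size s)%N -> spanned s (nth 0 s i).
Proof.
elim: s => // z s IH [|i] /= i_s.
  by exists 1, 0; split; [apply: (spanned_lin s).1 | rewrite scale1r addr0].
by exists 0, (nth 0 s i); split; [apply: IH | rewrite scale0r add0r].
Qed.

Lemma spanned_mem s x : x \in s -> spanned s x.
Proof.
by move=> xs; rewrite -(nth_index 0 xs); apply: spanned_in; rewrite index_mem.
Qed.

Lemma spanned_sub s (W : V -> Prop) x : lin_closed W ->
  (forall z, z \in s -> W z) -> spanned s x -> W x.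
Proof.
move=> Wl; elim: s x => [|z s IH] x Ws /=; first by move=> ->; apply: Wl.1.
case=> c [y [Sy ->]]; apply: Wl.2; first exact/Ws/mem_head.
by apply: IH => // z' z's; apply: Ws; rewrite inE z's orbT.
Qed.

(** Subspaces of a finitely spanned space have bases: induction on the spanning
    list, splitting off one vector of [W] that is not spanned by the tail. *)
Lemma basis_exists s (W : V -> Prop) : lin_closed W ->
  (forall x, W x -> spanned s x) -> exists N (b : 'I_N -> V), is_basis W b.
Proof.
elim: s W => [|z s IH] W Wl Ws.
  exists 0%N, (fun _ => 0); split=> [[]//|x /Ws /= ->].
  exists [ffun _ => 0]; split=> [|c _]; first by rewrite big_ord0.
  by apply/ffunP => -[].
have [Wt|] := pselect (forall x, W x -> spanned s x); first exact: IH.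
move=> /existsNP[w /not_implyP[Ww ws]].
pose W0 x := W x /\ spanned s x.
have W0l : lin_closed W0.
  split=> [|c x y [Wx sx] [Wy sy]].
    by split; [apply: Wl.1 | apply: (spanned_lin s).1].
  by split; [apply: Wl.2 | apply: (spanned_lin s).2].
have [N [b [Wb bU]]] := IH _ W0l (fun x W0x => W0x.2).
have [cw [yw [syw wE]]] := Ws _ Ww.
have cw0 : cw != 0.
  by apply: contra_notN ws => /eqP cw0; rewrite wE cw0 scale0r add0r.
exists N.+1, (fun i => if unlift ord0 i is Some j then b j else w); split.
  by move=> i; case: unliftP => // j _; case: (Wb j).
have sumE (c : {ffun 'I_N.+1 -> k}) :
    \sum_i c i *: (if unlift ord0 i is Some j then b j else w)
    = c ord0 *: w + \sum_j c (lift ord0 j) *: b j.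
  rewrite big_ord_recl unlift_none; congr (_ + _).
  by apply: eq_bigr => j _; rewrite liftK.
have sumW0 (c : 'I_N -> k) : W0 (\sum_j c j *: b j).
  by apply: lin_closed_sum => // j _; apply: lin_closedZ.
move=> x Wx; have [cx [yx [syx xE]]] := Ws _ Wx.
have W0x : W0 (x - (cx / cw) *: w).
  split; first by apply: lin_closedB => //; apply: lin_closedZ.
  rewrite wE xE scalerDr scalerA divfK // opprD addrACA subrr add0r.
  have sl := spanned_lin s.
  by apply: lin_closedB => //; apply: lin_closedZ.
have [c [cE cU]] := bU _ W0x.
exists [ffun i => if unlift ord0 i is Some j then c j else cx / cw]; split.
  rewrite sumE !ffunE unlift_none; apply: (canRL (addNKr _)).
  rewrite addrC cE; apply: eq_bigr => j _; by rewrite ffunE liftK.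
move=> c' c'E; rewrite sumE in c'E.
have c0 : c' ord0 = cx / cw.
  apply/eqP; rewrite -subr_eq0; apply: contra_notT ws => ne.
  have E : w = (c' ord0 - cx / cw)^-1 *:
      ((x - (cx / cw) *: w) - \sum_j c' (lift ord0 j) *: b j).
    rewrite c'E addrAC addrK -scalerBl scalerA mulVf ?scale1r //.
  rewrite E; apply: lin_closedZ; first exact: spanned_lin.
  apply: lin_closedB; [exact: spanned_lin | exact: W0x.2 |].
  exact: (sumW0 (fun j => c' (lift ord0 j))).2.
apply/ffunP => i; rewrite ffunE; case: unliftP => [j ->|->]; last by rewrite c0.
rewrite (cU [ffun j => c' (lift ord0 j)]) ?ffunE //.
rewrite c'E c0 addrC addKr; apply: eq_bigr => j' _; by rewrite ffunE.
Qed.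
End FiniteDimension.

Lemma basis_transport (k : fieldType) (V V' : lmodType k) (f : {linear V -> V'})
    (W : V -> Prop) (W' : V' -> Prop) N (b : 'I_N -> V) :
  lin_closed W -> (forall x, W x -> f x = 0 -> x = 0) ->
  (forall x, W x -> W' (f x)) -> (forall y, W' y -> exists2 x, W x & y = f x) ->
  is_basis W b -> is_basis W' (f \o b).
Proof.
move=> Wl f_inj fW fs [Wb bU]; split=> [i|y /fs[x Wx ->]]; first exact: fW.
have f_sum (c : {ffun 'I_N -> k}) :
    \sum_i c i *: (f \o b) i = f (\sum_i c i *: b i).
  by rewrite linear_sum; apply: eq_bigr => i _; rewrite linearZ.
have Wsum (c : {ffun 'I_N -> k}) : W (\sum_i c i *: b i).
  by apply: lin_closed_sum => // i _; apply: lin_closedZ.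
have [c [cE cU]] := bU _ Wx.
exists c; split=> [|c']; first by rewrite f_sum -cE.
rewrite f_sum => E; apply: cU; apply/eqP; rewrite -subr_eq0; apply/eqP.
by apply: f_inj; [apply: lin_closedB | rewrite linearB E subrr].
Qed.

(** * Words in the lowering operators *)

Section LoweringSpan.
Variables (n : nat) (k : fieldType) (V : lmodType k).
Variables E F : 'I_n -> nat -> {linear V -> V}.
Local Notation grade := ('I_n -> nat).

Definition gstep (nu : grade) i b : grade := fun j => (nu j + (i == j) * b)%N.

(** The combinations of words in the [F i b] applied to [v], graded by the total
    exponent of each letter. *)
Inductive Fspan (v : V) : grade -> V -> Prop :=
| Fspan_top : Fspan v (fun=> 0%N) v
| Fspan_zero nu : Fspan v nu 0
| Fspan_lin nu c x y : Fspan v nu x -> Fspan v nu y -> Fspan v nu (c *: x + y)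
| Fspan_F nu i b x : Fspan v nu x -> Fspan v (gstep nu i b) (F i b x).

Lemma Fspan_closed v nu : lin_closed (Fspan v nu).
Proof. by split=> [|c x y]; [apply: Fspan_zero | apply: Fspan_lin]. Qed.

Lemma Fspan_eq v nu nu' x : nu =1 nu' -> Fspan v nu x -> Fspan v nu' x.
Proof. by move=> /funext ->. Qed.

Hypothesis E0 : forall i x, E i 0 x = x.
Hypothesis F0 : forall i x, F i 0 x = x.

(** Finite spanning lists exist by induction on the total degree of [nu]: an
    element of positive degree is a combination of vectors [F i b y] with
    [0 < b <= nu i] and [y] of smaller degree. *)
Lemma Fspan_spanned v nu :
  exists s : seq V, forall x, Fspan v nu x -> spanned s x.
Proof.
have [M] := ubnP (\sum_j nu j); elim: M nu => // M IH nu; rewrite ltnS => nuM.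
pose low (ib : 'I_n * nat) : grade := fun j => (nu j - (ib.1 == j) * ib.2)%N.
have lowP (ib : 'I_n * nat) : exists s : seq V,
    (0 < ib.2 <= nu ib.1)%N -> forall x, Fspan v (low ib) x -> spanned s x.
  case: ib => i b /=; have [/andP[b0 bnu]|] := boolP (0 < b <= nu i)%N; last first.
    by exists [::].
  have [|s sP] := IH (low (i, b)); last by exists s.
  apply: leq_trans nuM; rewrite (bigD1 i) //= [X in (_ < X)%N](bigD1 i) //=.
  rewrite /low /= eqxx mul1n -addSn leq_add //.
    by rewrite ltn_subrL b0 (leq_trans b0).
  by apply: leq_sum => j _; rewrite leq_subr.
have [/= g gP] := choice lowP.
pose B := (\sum_j nu j).+1.
pose S := v :: flatten [seq [seq F ib.1 ib.2 y | y <- g ib]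
  | ib <- [seq (i, b) | i <- enum 'I_n, b <- iota 0 B]].
have Sl := spanned_lin S; exists S => x.
suff gen nu' : Fspan v nu' x -> nu' = nu -> spanned S x by move=> /gen; apply.
elim=> {nu' x} [|nu'|nu' c x y _ IHx _ IHy|nu' i b x vx IHx] E'.
- exact/spanned_mem/mem_head.
- exact: Sl.1.
- by apply: Sl.2; auto.
have [b0|b0] := posnP b.
  rewrite b0 F0; apply: IHx; rewrite -E' b0; apply/funext => j.
  by rewrite /gstep muln0 addn0.
have nui : nu i = (nu' i + b)%N by rewrite -E' /gstep eqxx mul1n.
have : spanned (g (i, b)) x.
  apply: (gP (i, b)); first by rewrite /= b0 nui leq_addl.
  by apply: Fspan_eq vx => j; rewrite /low /= -E' /gstep addnK.
have Sg y : y \in g (i, b) -> spanned S (F i b y).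
  move=> yg; apply: spanned_mem; rewrite inE; apply/orP; right.
  apply/flattenP; exists [seq F i b y | y <- g (i, b)]; last exact: map_f.
  apply/mapP; exists (i, b) => //; apply/allpairsP; exists (i, b).
  split=> //; first by rewrite mem_enum.
  rewrite mem_iota add0n /B ltnS (bigD1 i) //= nui.
  by rewrite addnAC leq_addl.
apply: (@spanned_sub _ _ _ (fun x => spanned S (F i b x))) => //.
split=> [|c y z Sy Sz]; first by rewrite linear0; apply: Sl.1.
by rewrite linearP; apply: Sl.2.
Qed.

Section Raise.
Variables (v : V) (N : nat).
Hypothesis Ev : forall i b, (0 < b)%N -> E i b v = 0.
Hypothesis EFne : forall i j b c x, i != j -> E i b (F j c x) = F j c (E i b x).
Hypothesis EFeq : forall i b c nu x, Fspan v nu x -> (b < N)%N -> (c < N)%N ->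
  exists beta : nat -> k, E i b (F i c x) =
    \sum_(t < b.+1 | (t <= c)%N) beta t *: F i (c - t) (E i (b - t) x).

(** Commuting [E i b] past a word of degree [nu] to the highest weight vector only
    meets exponents at most [nu i], so a commutation rule for exponents below [N]
    suffices when all [nu j < N]. *)
Lemma Fspan_raise nu x : Fspan v nu x -> (forall j, (nu j < N)%N) ->
  forall i b, (b < N)%N ->
    ((nu i < b)%N -> E i b x = 0) /\
    (forall nu', nu =1 gstep nu' i b -> Fspan v nu' (E i b x)).
Proof.
elim=> {nu x} [|nu|nu c x y _ IHx _ IHy|nu j c x vx IH] nuN i b bN.
- split=> [|nu' nuE]; first exact: Ev.
  have b0 : b = 0%N by have := nuE i; rewrite /gstep eqxx; lia.
  rewrite b0 E0; apply: Fspan_eq (Fspan_top v) => j.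
  by have := nuE j; rewrite b0 /gstep; lia.
- by rewrite linear0; split=> // nu' _; apply: Fspan_zero.
- have [X1 X2] := IHx nuN i b bN; have [Y1 Y2] := IHy nuN i b bN.
  rewrite linearP; split=> [lt|nu' nuE].
    by rewrite X1 ?Y1 // scaler0 addr0.
  by apply: Fspan_lin; [apply: X2 | apply: Y2].
have nuN' l : (nu l < N)%N by apply: leq_ltn_trans (nuN l); apply: leq_addr.
have {}IH := IH nuN'.
have cN : (c < N)%N.
  by apply: leq_ltn_trans (nuN j); rewrite /gstep eqxx mul1n leq_addl.
have [ij|ij] := eqVneq i j; last first.
  rewrite EFne //; have [X1 X2] := IH i b bN; split=> [lt|nu' nuE].
    by rewrite X1 ?linear0 //; apply: leq_ltn_trans lt; apply: leq_addr.
  have cnu : (c <= nu' j)%N.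
    by have := nuE j; rewrite /gstep eqxx (negPf ij) /=; lia.
  pose nu2 : grade := fun l => (nu' l - (j == l) * c)%N.
  have /X2 H : nu =1 gstep nu2 i b.
    move=> l; have := nuE l; rewrite /gstep /nu2.
    by case: (eqVneq j l) => [<-|_] /=; lia.
  apply: Fspan_eq (Fspan_F j c H) => l; rewrite /gstep /nu2.
  by case: (eqVneq j l) => [<-|_] /=; lia.
rewrite -{j}ij in nuN *; have [beta ->] := EFeq i vx bN cN.
have dN (t : nat) : (b - t < N)%N by apply: leq_ltn_trans bN; apply: leq_subr.
split=> [lt|nu' nuE].
  rewrite big1 // => t tc; have [X1 _] := IH i (b - t)%N (dN t).
  rewrite X1 ?linear0 ?scaler0 //.
  by move: lt; rewrite /gstep eqxx; lia.
apply: lin_closed_sum; first exact: Fspan_closed.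
move=> [t /= tb] tc; apply: lin_closedZ; first exact: Fspan_closed.
have [X1 X2] := IH i (b - t)%N (dN t).
case: (ltnP (nu i) (b - t)) => [/X1 ->|le].
  by rewrite linear0; apply: Fspan_zero.
pose nu2 : grade := fun l => (nu l - (i == l) * (b - t))%N.
have /X2 H : nu =1 gstep nu2 i (b - t).
  by move=> l; rewrite /gstep /nu2; case: (eqVneq i l) => [<-|_] /=; lia.
apply: Fspan_eq (Fspan_F i (c - t) H) => l; have := nuE l; rewrite /gstep /nu2.
by case: (eqVneq i l) => [<-|_] /=; lia.
Qed.
End Raise.
End LoweringSpan.

(** * Comparing two highest weight modules *)

Section PairOperator.
Variables (k : fieldType) (V V' : lmodType k).
Variables (f : {linear V -> V}) (g : {linear V' -> V'}).

Definition pairop (x : V * V') : V * V' := (f x.1, g x.2).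

Fact pairop_linear : linear pairop.
Proof. by move=> c x y; rewrite /pairop !linearP. Qed.
HB.instance Definition _ :=
  GRing.isLinear.Build k (V * V')%type (V * V')%type _ pairop pairop_linear.
End PairOperator.

Section HighestWeight.
Variables (n : nat) (a : 'I_n -> 'I_n -> int) (k : fieldType).
Variable B : 'I_n -> int -> nat -> k.
Hypothesis B_sep : forall i m m', (forall t, B i m t = B i m' t) -> m = m'.
Local Notation weight := ('I_n -> int).
Local Notation grade := ('I_n -> nat).

Definition lower (m : weight) (nu : grade) : weight :=
  fun j => m j - \sum_i a j i * (nu i)%:Z.

Hypothesis a_inj : forall (nu nu' : grade),
  (forall j, \sum_i a j i * (nu i)%:Z = \sum_i a j i * (nu' i)%:Z) -> nu = nu'.

Lemma lower_inj m nu nu' : lower m nu = lower m nu' -> nu = nu'.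
Proof.
move=> e; apply: a_inj => j; have := congr1 (fun f : weight => f j) e.
by move=> /addrI/oppr_inj.
Qed.

Lemma lower0 m : lower m (fun=> 0%N) = m.
Proof.
by apply/funext => j; rewrite /lower big1 ?subr0 // => i _; rewrite mulr0.
Qed.

Lemma lower_gstep m nu i b :
  lower m (gstep nu i b) = fun j => lower m nu j - a j i * b%:Z.
Proof.
apply/funext => j; rewrite /lower -addrA -opprD; congr (_ - _).
rewrite (bigD1 i) // [in RHS](bigD1 i) //= /gstep eqxx mul1n PoszD mulrDr.
rewrite -addrA [X in _ + X]addrC addrA; congr (_ + _ + _).
by apply: eq_bigr => l /negPf li; rewrite eq_sym li addn0.
Qed.

Lemma lower_add m nu nu' :
  lower (lower m nu) nu' = lower m (fun j => nu j + nu' j)%N.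
Proof.
apply/funext => j; rewrite /lower -addrA -opprD; congr (_ - _).
by rewrite -big_split; apply: eq_bigr => i _; rewrite PoszD mulrDr.
Qed.

(** What is used of an irreducible highest weight module.  Irreducibility enters
    as [hw_gen]; the torus does not occur in it, since subspaces stable under the
    [E] and [F] are stable under the torus when q = 1. *)
Record hw_module (V : lmodType k) (E F H : 'I_n -> nat -> {linear V -> V})
    (wt : weight -> V -> Prop) (lam : weight) (v : V) : Prop := HwModule {
  hw_E0 : forall i x, E i 0 x = x;
  hw_F0 : forall i x, F i 0 x = x;
  hw_EFne : forall i j b c x, i != j -> E i b (F j c x) = F j c (E i b x);
  hw_EFeq : forall m i b c x, wt m x -> E i b (F i c x) =
    \sum_(t < b.+1 | (t <= c)%N)
      B i (m i + b%:Z - c%:Z) t *: F i (c - t)%N (E i (b - t)%N x);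
  hw_lin : forall m, lin_closed (wt m);
  hw_F : forall m i b x, wt m x -> wt (fun j => m j - a j i * b%:Z) (F i b x);
  hw_H : forall m i t x, wt m x -> H i t x = B i (m i) t *: x;
  hw_v : wt lam v;
  hw_Ev : forall i b, (0 < b)%N -> E i b v = 0;
  hw_neq0 : v != 0;
  hw_gen : forall S : V -> Prop, lin_closed S ->
    (forall i b x, S x -> S (E i b x)) -> (forall i b x, S x -> S (F i b x)) ->
    (exists2 x, S x & x != 0) -> forall x, S x
}.

Lemma Fspan_grade0 (V : lmodType k) (F : 'I_n -> nat -> {linear V -> V}) v x :
  (forall i y, F i 0 y = y) -> Fspan F v (fun=> 0%N) x -> exists c, x = c *: v.
Proof.
move=> F0.
suff gen nu : Fspan F v nu x -> nu = (fun=> 0%N) -> exists c, x = c *: v.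
  by move=> /gen; apply.
elim=> {nu x} [|nu|nu c x y _ IHx _ IHy|nu i b x _ IH] nu0.
- by exists 1; rewrite scale1r.
- by exists 0; rewrite scale0r.
- have [c1 ->] := IHx nu0; have [c2 ->] := IHy nu0.
  by exists (c * c1 + c2); rewrite scalerDl scalerA.
have z j : nu j = 0%N.
  have /eqP := congr1 (fun f : grade => f j) nu0.
  by rewrite addn_eq0 => /andP[/eqP].
have [|c ->] := IH; first by apply/funext.
have b0 : b = 0%N.
  have := congr1 (fun f : grade => f i) nu0.
  by rewrite /gstep eqxx mul1n z add0n.
by exists c; rewrite b0 F0.
Qed.

Section OneModule.
Variables (V : lmodType k) (E F H : 'I_n -> nat -> {linear V -> V}).
Variables (wt : weight -> V -> Prop) (lam : weight) (v : V).
Hypothesis hw : hw_module E F H wt lam v.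
Local Notation Fspan := (Fspan F).

Lemma Fspan_wt m w nu x : wt m w -> Fspan w nu x -> wt (lower m nu) x.
Proof.
move=> ww; elim=> {nu x} [|nu|nu c x y _ IHx _ IHy|nu i b x _ IH].
- by rewrite lower0.
- exact: (hw_lin hw _).1.
- exact: (hw_lin hw _).2.
- by rewrite lower_gstep; apply: (hw_F hw).
Qed.

Inductive sum_wt (P : weight -> Prop) : V -> Prop :=
| sum_wt0 : sum_wt P 0
| sum_wtD m x y : P m -> wt m x -> sum_wt P y -> sum_wt P (x + y).

(** A product of operators [H i t - c], one for each summand, kills all the
    summands and is invertible on the weight space of [m]. *)
Lemma wt_independent m x : wt m x -> sum_wt (fun m' => m' <> m) x -> x = 0.
Proof.
move=> wx sx; suff [T Tx [_ Tm]] : exists2 T : {linear V -> V}, T x = 0 &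
    (forall m' y, wt m' y -> exists c, T y = c *: y) /\
    exists2 c, c != 0 & forall y, wt m y -> T y = c *: y.
  have [c c0 cE] := Tm; apply/eqP; have /eqP := cE _ wx.
  by rewrite Tx eq_sym scaler_eq0 (negPf c0).
elim: sx => {x wx} [|m' x y m'm wx _ [T Ty [Tw [c c0 Tm]]]].
  exists idfun; rewrite ?linear0 //; split=> [m' y _|].
    by exists 1; rewrite scale1r.
  by exists 1; rewrite ?oner_eq0 // => y _; rewrite scale1r.
have [i [t Bit]] : exists i t, B i (m' i) t <> B i (m i) t.
  apply: contra_notP m'm => no; apply/funext => i; apply: (@B_sep i) => t.
  by apply: contra_notP no => ne; exists i, t.
pose S y : V := H i t y - B i (m' i) t *: y.
have S_lin : linear S.
  move=> e y1 y2; rewrite /S linearP scalerBr scalerDr !scalerA mulrC opprD.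
  by rewrite addrACA.
pose SL := GRing.isLinear.Build k V V _ S S_lin.
pose Sl : {linear V -> V} := HB.pack S SL.
have Sw m1 y1 : wt m1 y1 -> S y1 = (B i (m1 i) t - B i (m' i) t) *: y1.
  by move=> w1; rewrite /S (hw_H hw _ _ w1) scalerBl.
have wZ m1 e y1 : wt m1 y1 -> wt m1 (e *: y1).
  by move=> w1; apply: lin_closedZ => //; apply: (hw_lin hw).
exists (Sl \o T).
  rewrite /= linearD Ty addr0; have [e ->] := Tw _ _ wx.
  by rewrite (Sw m') ?subrr ?scale0r //; apply: wZ.
split=> [m1 y1 w1 /=|].
  have [e ->] := Tw _ _ w1; rewrite (Sw m1); last exact: wZ.
  by eexists; rewrite scalerA.
exists ((B i (m i) t - B i (m' i) t) * c).
  by rewrite mulf_neq0 // subr_eq0 eq_sym; apply/eqP.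
by move=> y1 w1 /=; rewrite Tm // (Sw m) ?scalerA //; apply: wZ.
Qed.

Inductive Fsum (w : V) : V -> Prop :=
| Fsum0 : Fsum w 0
| FsumD nu x y : Fspan w nu x -> Fsum w y -> Fsum w (x + y).

Lemma Fsum_closed w : lin_closed (Fsum w).
Proof.
split=> [|c x y]; first exact: Fsum0.
elim=> {x} [|nu x x' vx _ IH] Sy; first by rewrite scaler0 add0r.
rewrite scalerDr -addrA; apply: (@FsumD _ nu); last exact: IH.
by apply: lin_closedZ => //; apply: Fspan_closed.
Qed.

Lemma Fsum_Fspan w nu x : Fspan w nu x -> Fsum w x.
Proof. by move=> wx; rewrite -[x]addr0; apply: FsumD wx (Fsum0 w). Qed.

Lemma primitive_raise m w N : wt m w ->
  (forall i b, (0 < b)%N -> E i b w = 0) ->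
  forall nu x, Fspan w nu x -> (forall j, (nu j < N)%N) ->
  forall i b, (b < N)%N ->
    ((nu i < b)%N -> E i b x = 0) /\
    (forall nu', nu =1 gstep nu' i b -> Fspan w nu' (E i b x)).
Proof.
move=> ww Ew nu x; apply: Fspan_raise => //.
- exact: hw_E0 hw.
- exact: hw_EFne hw.
- move=> i b c nu' y wy _ _; exists (B i (lower m nu' i + b%:Z - c%:Z)).
  by rewrite (hw_EFeq hw _ _ _ (Fspan_wt ww wy)).
Qed.

(** The words in the [F] applied to [w] span a subspace stable under the [E] by
    [Fspan_raise], and [w] generates. *)
Lemma primitive_Fsum m w : wt m w -> w != 0 ->
  (forall i b, (0 < b)%N -> E i b w = 0) -> forall x, Fsum w x.
Proof.
move=> ww w0 Ew; apply: (hw_gen hw); first exact: Fsum_closed.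
- move=> i b x; elim=> {x} [|nu x y wx _ IH].
    by rewrite linear0; apply: Fsum0.
  rewrite linearD; apply: lin_closedD => //; first exact: Fsum_closed.
  pose N := (\sum_j nu j + b).+1.
  have nuN j : (nu j < N)%N by rewrite ltnS (bigD1 j) //= -addnA leq_addr.
  have bN : (b < N)%N by rewrite ltnS leq_addl.
  have [X1 X2] := primitive_raise ww Ew wx nuN i bN.
  case: (ltnP (nu i) b) => [/X1 ->|le]; first exact: Fsum0.
  apply: (@Fsum_Fspan _ (fun j => nu j - (i == j) * b)%N); apply: X2 => j.
  by rewrite /gstep; case: (eqVneq i j) => [<-|_] /=; lia.
- move=> i b x; elim=> {x} [|nu x y wx _ IH].
    by rewrite linear0; apply: Fsum0.
  by rewrite linearD; apply: FsumD IH; apply: Fspan_F wx.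
- by exists w => //; apply: (@Fsum_Fspan _ (fun=> 0%N)); apply: Fspan_top.
Qed.

(** All vectors are sums of elements of the [Fspan v nu']; weights being
    independent, only [nu' = nu] contributes to the weight [lam - nu]. *)
Lemma wt_Fspan nu x : wt (lower lam nu) x -> Fspan v nu x.
Proof.
move=> wx.
have [x1 vx1 [x2 sx2 xE]] : exists2 x1, Fspan v nu x1 &
    exists2 x2, sum_wt (fun m => m <> lower lam nu) x2 & x = x1 + x2.
  have := primitive_Fsum (hw_v hw) (hw_neq0 hw) (hw_Ev hw) x.
  elim=> {wx x} [|nu' x y vx _ [x1 vx1 [x2 sx2 ->]]].
    exists 0; first exact: Fspan_zero.
    by exists 0; [apply: sum_wt0 | rewrite addr0].
  have vx' := Fspan_wt (hw_v hw) vx.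
  have [E'|ne] := pselect (nu' = nu).
    exists (x + x1); last by exists x2; rewrite ?addrA.
    by rewrite E' in vx; apply: lin_closedD => //; apply: Fspan_closed.
  exists x1 => //; exists (x + x2); last by rewrite addrCA.
  by apply: sum_wtD vx' sx2 => /lower_inj.
have wx1 : wt (lower lam nu) x1 := Fspan_wt (hw_v hw) vx1.
have x20 : x2 = 0.
  apply: wt_independent sx2.
  rewrite (_ : x2 = x - x1); last by rewrite xE addrC addKr.
  by apply: lin_closedB => //; apply: (hw_lin hw).
by rewrite xE x20 addr0.
Qed.

(** A primitive vector of weight below [lam] would generate a submodule missing
    the highest weight. *)
Lemma primitive_eq0 nu w : Fspan v nu w -> nu <> (fun=> 0%N) ->
  (forall i b, (0 < b)%N -> E i b w = 0) -> w = 0.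
Proof.
move=> vw nu0 Ew; apply/eqP; apply: contraT => w0.
have ww := Fspan_wt (hw_v hw) vw.
have sv : sum_wt (fun m => m <> lam) v.
  elim: (primitive_Fsum ww w0 Ew v) => [|nu' x y wx _ sy]; first exact: sum_wt0.
  apply: sum_wtD (Fspan_wt ww wx) sy; rewrite lower_add -{2}[lam]lower0.
  move=> /lower_inj E'; apply: nu0; apply/funext => j.
  have /eqP := congr1 (fun f : grade => f j) E'.
  by rewrite addn_eq0 => /andP[/eqP].
by have := hw_neq0 hw; rewrite (wt_independent (hw_v hw) sv) eqxx.
Qed.

Lemma exists_raise nu w : Fspan v nu w -> w != 0 -> nu <> (fun=> 0%N) ->
  exists i b nu', [/\ (0 < b)%N, nu =1 gstep nu' i b, E i b w != 0
    & (\sum_j nu' j < \sum_j nu j)%N].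
Proof.
move=> vw w0 nu0.
have [i [b [b0 Eb]]] : exists i b, (0 < b)%N /\ E i b w != 0.
  apply: contraPP w0 => no; rewrite (primitive_eq0 vw) ?eqxx // => i b b0.
  by apply: contra_notP no => /eqP; exists i, b.
exists i, b, (fun j => nu j - (i == j) * b)%N.
have le : (b <= nu i)%N.
  rewrite leqNgt; apply: contraNN Eb => lt; apply/eqP.
  pose N := (\sum_j nu j + b).+1.
  have nuN j : (nu j < N)%N by rewrite ltnS (bigD1 j) //= -addnA leq_addr.
  have bN : (b < N)%N by rewrite ltnS leq_addl.
  by have [] := primitive_raise (hw_v hw) (hw_Ev hw) vw nuN i bN; auto.
split=> // [j|]; first by rewrite /gstep; case: (eqVneq i j) => [<-|_] /=; lia.
rewrite (bigD1 i) //= [X in (_ < X)%N](bigD1 i) //= eqxx mul1n.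
rewrite -addSn leq_add //; first by rewrite ltn_subrL b0 (leq_trans b0).
by apply: leq_sum => j _; rewrite leq_subr.
Qed.
End OneModule.

Section Pair.
Variable (p r : nat).
Hypothesis B_period : forall i m u t, (t < p ^ r)%N ->
  B i (m + u * (p ^ r)%:Z) t = B i m t.
Variables (V V' : lmodType k).
Variables (E F H : 'I_n -> nat -> {linear V -> V}).
Variables (E' F' H' : 'I_n -> nat -> {linear V' -> V'}).
Variables (wt : weight -> V -> Prop) (wt' : weight -> V' -> Prop).
Variables (lam lam' : weight) (v : V) (v' : V').
Hypothesis hw : hw_module E F H wt lam v.
Hypothesis hw' : hw_module E' F' H' wt' lam' v'.
Variable u : weight.
Hypothesis lamE : forall j, lam' j = lam j + u j * (p ^ r)%:Z.

Let EE i b : {linear (V * V')%type -> (V * V')%type} := pairop (E i b) (E' i b).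
Let FF i b : {linear (V * V')%type -> (V * V')%type} := pairop (F i b) (F' i b).
Let D := Fspan FF (v, v').

Let D_fst nu x : D nu x -> Fspan F v nu x.1.
Proof.
elim=> {nu x} [|nu|nu c x y _ IHx _ IHy|nu i b x _ IH] /=.
- exact: Fspan_top.
- exact: Fspan_zero.
- exact: Fspan_lin.
- exact: Fspan_F.
Qed.

Let D_snd nu x : D nu x -> Fspan F' v' nu x.2.
Proof.
elim=> {nu x} [|nu|nu c x y _ IHx _ IHy|nu i b x _ IH] /=.
- exact: Fspan_top.
- exact: Fspan_zero.
- exact: Fspan_lin.
- exact: Fspan_F.
Qed.

Lemma Fspan_pair_fst nu x : Fspan F v nu x -> exists2 z, D nu z & x = z.1.
Proof.
elim=> {nu x} [|nu|nu c x y _ [zx Dx ->] _ [zy Dy ->]|nu i b x _ [z Dz ->]].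
- by exists (v, v') => //; apply: Fspan_top.
- by exists 0 => //; apply: Fspan_zero.
- by exists (c *: zx + zy) => //; apply: Fspan_lin.
- by exists (FF i b z) => //; apply: Fspan_F.
Qed.

Lemma Fspan_pair_snd nu x : Fspan F' v' nu x -> exists2 z, D nu z & x = z.2.
Proof.
elim=> {nu x} [|nu|nu c x y _ [zx Dx ->] _ [zy Dy ->]|nu i b x _ [z Dz ->]].
- by exists (v, v') => //; apply: Fspan_top.
- by exists 0 => //; apply: Fspan_zero.
- by exists (c *: zx + zy) => //; apply: Fspan_lin.
- by exists (FF i b z) => //; apply: Fspan_F.
Qed.

(** The commutation coefficients [B i m t] with [t < p^r] agree for the two
    modules, so E maps the diagonal span to itself. *)
Lemma pair_raise nu x : D nu x -> (forall j, (nu j < p ^ r)%N) ->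
  forall i b, (b < p ^ r)%N -> forall nu', nu =1 gstep nu' i b ->
  D nu' (EE i b x).
Proof.
move=> Dx nuN i b bN; have EE0 j z : EE j 0 z = z.
  by case: z => y y'; rewrite /= /pairop (hw_E0 hw) (hw_E0 hw').
have EEv j c : (0 < c)%N -> EE j c (v, v') = 0.
  by move=> c0; rewrite /= /pairop (hw_Ev hw) // (hw_Ev hw').
have EFne j l c e z : j != l -> EE j c (FF l e z) = FF l e (EE j c z).
  by move=> jl; rewrite /= /pairop /= (hw_EFne hw) // (hw_EFne hw').
have sum_pair I (s : seq I) (P : pred I) (f : I -> V * V') :
    \sum_(t <- s | P t) f t
    = (\sum_(t <- s | P t) (f t).1, \sum_(t <- s | P t) (f t).2).
  elim: s => [|t s IH]; first by rewrite !big_nil.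
  by rewrite !big_cons IH; case: ifP.
apply: (proj2 (Fspan_raise EE0 EEv EFne _ Dx nuN i bN)).
move=> j c e nu1 y Dy cN eN; exists (B j (lower lam nu1 j + c%:Z - e%:Z)).
have wy := Fspan_wt hw (hw_v hw) (D_fst Dy).
have wy' := Fspan_wt hw' (hw_v hw') (D_snd Dy).
rewrite [LHS]/= /pairop /= (hw_EFeq hw _ _ _ wy) (hw_EFeq hw' _ _ _ wy').
rewrite sum_pair; congr (_, _); apply: eq_bigr => t te /=.
congr (_ *: _); rewrite -[in RHS](@B_period j _ (u j)).
  by congr (B j _ _); rewrite /lower lamE; ring.
exact: leq_ltn_trans eN.
Qed.

(** Induction on the degree: a raising operator that does not kill [x.1] leads to
    a smaller degree, and in degree 0 there is only the line through [(v, v')]. *)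
Lemma pair_inj nu x :
  D nu x -> (forall j, (nu j < p ^ r)%N) -> x.2 = 0 -> x.1 = 0.
Proof.
have [M] := ubnP (\sum_j nu j).
elim: M nu x => // M IH nu x; rewrite ltnS => nuM.
move=> Dx nuN x2; have [nu0|nu0] := pselect (nu = (fun=> 0%N)).
  rewrite nu0 in Dx; have [|c xE] := Fspan_grade0 _ Dx.
    by move=> j [y y']; rewrite /= /pairop (hw_F0 hw) (hw_F0 hw').
  move: x2; rewrite xE /= => /eqP.
  rewrite scaler_eq0 (negPf (hw_neq0 hw')) orbF.
  by move=> /eqP ->; rewrite scale0r.
apply/eqP; apply: contraT => x1.
have [i [b [nu' [b0 nuE Eb lt]]]] := exists_raise hw (D_fst Dx) x1 nu0.
have nuN' j : (nu' j < p ^ r)%N.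
  by apply: leq_ltn_trans (nuN j); rewrite nuE leq_addr.
have bN : (b < p ^ r)%N.
  by apply: leq_ltn_trans (nuN i); rewrite nuE /gstep eqxx mul1n leq_addl.
have := IH nu' (EE i b x) (leq_trans lt nuM) (pair_raise Dx nuN bN nuE) nuN'.
by rewrite /= x2 linear0 => /(_ erefl) /eqP; rewrite (negPf Eb).
Qed.


Lemma pair_fst_onto nu x : wt (lower lam nu) x -> exists2 z, D nu z & x = z.1.
Proof. by move/(wt_Fspan hw); apply: Fspan_pair_fst. Qed.

Lemma pair_snd_onto nu x : wt' (lower lam' nu) x -> exists2 z, D nu z & x = z.2.
Proof. by move/(wt_Fspan hw'); apply: Fspan_pair_snd. Qed.

Lemma pair_wt nu z : D nu z -> wt (lower lam nu) z.1 /\ wt' (lower lam' nu) z.2.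
Proof.
move=> Dz; split; first exact: (Fspan_wt hw (hw_v hw) (D_fst Dz)).
exact: (Fspan_wt hw' (hw_v hw') (D_snd Dz)).
Qed.

Lemma pair_basis nu : exists N (b : 'I_N -> (V * V')%type), is_basis (D nu) b.
Proof.
have F0 j z : FF j 0 z = z.
  by case: z => y y'; rewrite /= /pairop (hw_F0 hw) (hw_F0 hw').
have [s sP] := Fspan_spanned F0 (v, v') nu.
by apply: basis_exists sP; apply: Fspan_closed.
Qed.
End Pair.

Section SameDimension.
Variables (p r : nat).
Hypothesis B_period : forall i m u t, (t < p ^ r)%N ->
  B i (m + u * (p ^ r)%:Z) t = B i m t.
Variables (V V' : lmodType k).
Variables (E F H : 'I_n -> nat -> {linear V -> V}).
Variables (E' F' H' : 'I_n -> nat -> {linear V' -> V'}).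
Variables (wt : weight -> V -> Prop) (wt' : weight -> V' -> Prop).
Variables (lam lam' : weight) (v : V) (v' : V').
Hypothesis hw : hw_module E F H wt lam v.
Hypothesis hw' : hw_module E' F' H' wt' lam' v'.
Variable u : weight.
Hypothesis lamE : forall j, lam' j = lam j + u j * (p ^ r)%:Z.

Lemma Fspan_swap nu x :
  Fspan (fun i b => pairop (F i b) (F' i b) : {linear _ -> _}) (v, v') nu x ->
  Fspan (fun i b => pairop (F' i b) (F i b) : {linear _ -> _}) (v', v) nu
    (x.2, x.1).
Proof.
elim=> {nu x} [|nu|nu c x y _ IHx _ IHy|nu i b x _ IH] /=.
- exact: Fspan_top.
- exact: Fspan_zero.
- exact: (Fspan_lin c IHx IHy).
- exact: (Fspan_F i b IH).
Qed.

(** The diagonal span is the graph of an isomorphism, by [pair_inj] for the two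
    modules in either order. *)
Lemma weight_spaces_same_dim nu : (forall j, (nu j < p ^ r)%N) ->
  exists N (b : 'I_N -> V) (b' : 'I_N -> V'),
    is_basis (wt (lower lam nu)) b /\ is_basis (wt' (lower lam' nu)) b'.
Proof.
move=> nuN; have [N [b bP]] := pair_basis hw hw' nu.
have Dl := Fspan_closed
  (fun i b => pairop (F i b) (F' i b) : {linear _ -> _}) (v, v') nu.
have lamE' j : lam j = lam' j + (- u j) * (p ^ r)%:Z.
  by rewrite lamE mulNr addrK.
exists N, (fst \o b), (snd \o b); split.
- apply: (basis_transport (f := fst) Dl _ _ _ bP) => [x Dx x1|x Dx|y wy].
  + have x2 := pair_inj B_period hw' hw lamE' (Fspan_swap Dx) nuN x1.
    by rewrite [x]surjective_pairing x1 [x.2]x2.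
  + exact: (pair_wt hw hw' Dx).1.
  + exact: (pair_fst_onto F' v' hw wy).
- apply: (basis_transport (f := snd) Dl _ _ _ bP) => [x Dx x2|x Dx|y wy].
  + have x1 := pair_inj B_period hw hw' lamE Dx nuN x2.
    by rewrite [x]surjective_pairing x1 x2.
  + exact: (pair_wt hw hw' Dx).2.
  + exact: (pair_snd_onto F v hw' wy).
Qed.
End SameDimension.
End HighestWeight.

(** * The Cartan matrix is invertible *)

Section CartanMatrix.
Variables (F : archiRealFieldType) (V : vectType F) (R : root_system V).
Variables (n : nat) (Pi : n.-tuple V).
Hypothesis hPi : is_root_basis R Pi.

Local Notation roots := Defs.roots.
Local Notation co j := (coroot R (tnth Pi j)).

Lemma simple_root j : tnth Pi j \in roots R.
Proof. by case: hPi => sub _ _; apply/sub/mem_tnth. Qed.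

Lemma coroot_root alpha : alpha \in roots R -> coroot R alpha alpha = 2.
Proof. by move: alpha; case: (R). Qed.

Lemma reflection_root alpha beta : alpha \in roots R -> beta \in roots R ->
  beta - (coroot R alpha beta : F) *: alpha \in roots R.
Proof. by move: alpha beta; case: (R). Qed.

Lemma coroot_int alpha beta : alpha \in roots R -> beta \in roots R ->
  (coroot R alpha beta : F) \is a Num.int.
Proof. by move: alpha beta; case: (R). Qed.

Lemma pairingE mu i : is_weight R mu -> (pairing R Pi mu i)%:~R = co i mu :> F.
Proof. by move=> wmu; rewrite /pairing floorK //; apply/wmu/simple_root. Qed.

Lemma root_is_weight beta : beta \in roots R -> is_weight R beta.
Proof. by move=> rb alpha ra; apply: coroot_int. Qed.

Lemma cartanE i j : (cartan R Pi i j)%:~R = co i (tnth Pi j) :> F.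
Proof. by rewrite /cartan pairingE //; apply/root_is_weight/simple_root. Qed.

Lemma cartan_diag i : cartan R Pi i i = 2.
Proof. by apply: (@intr_inj F); rewrite cartanE coroot_root ?simple_root. Qed.

Let s := undup (roots R).
Let refl j (x : V) : V := x - (co j x : F) *: tnth Pi j.

Let co_refl j x : co j (refl j x) = - co j x.
Proof.
rewrite /refl linearB linearZ /= coroot_root ?simple_root //.
by rewrite -[_ *: _]/(_ * _) mulr_natr mulr2n opprD addrA subrr add0r.
Qed.

Let reflK j : involutive (refl j).
Proof.
by move=> x; rewrite {1}/refl co_refl scaleNr opprK /refl subrK.
Qed.

Let perm_refl j : perm_eq (map (refl j) s) s.
Proof.
apply: uniq_perm; rewrite ?undup_uniq //.
  by rewrite map_inj_uniq ?undup_uniq //; apply: inv_inj (reflK j).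
have rs x : x \in s -> refl j x \in s.
  by rewrite !mem_undup => xr; apply: reflection_root => //; apply: simple_root.
move=> x; apply/mapP/idP => [[y ys ->]|xs]; first exact: rs.
by exists (refl j x); rewrite ?reflK ?rs.
Qed.

Let Pi_basis : basis_of fullv Pi. Proof. by case: hPi. Qed.

(** Reindex the left sum by the simple reflection [j], which permutes the roots:
    the coroot [j] changes sign, and of the coordinates only the [j]-th moves. *)
Lemma sum_coord_coroot i j :
  (\sum_(b <- s) coord Pi i b * (co j b : F)) *+ 2 =
  (\sum_(b <- s) (co j b : F) ^+ 2) *+ (i == j).
Proof.
have free_Pi := basis_free Pi_basis.
have cPi : coord Pi i (tnth Pi j) = (i == j)%:R.
  by rewrite (tnth_nth 0) coord_free // eq_sym.
rewrite mulr2n -{1}(perm_big _ (perm_refl j)) big_map /= -big_split /= -sumrMnl.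
apply: eq_bigr => b _; rewrite co_refl /refl linearB linearZ /= cPi.
rewrite mulr_natr expr2; case: (i == j); rewrite ?mulr1n ?mulr0n; ring.
Qed.

(** [sum_coord_coroot] says that the Gram matrix of the coordinates of the roots
    times the transposed Cartan matrix is diagonal with positive entries. *)
Lemma cartan_unit : \matrix_(j < n, i < n) (co j (tnth Pi i) : F) \in unitmx.
Proof.
set A := \matrix_(j, i) _.
pose S := \matrix_(i < n, l < n) (\sum_(b <- s) coord Pi i b * coord Pi l b).
have norm_gt0 j : 0 < \sum_(b <- s) (co j b : F) ^+ 2.
  rewrite (big_rem (tnth Pi j)) /=; last by rewrite mem_undup simple_root.
  rewrite coroot_root ?simple_root // ltr_pwDl ?exprn_gt0 ?ltr0n //.
  by apply: sumr_ge0 => b _; rewrite sqr_ge0.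
have SA : S *m A^T = diag_mx (\row_j ((\sum_(b <- s) (co j b : F) ^+ 2) / 2)).
  apply/matrixP => i j; rewrite !mxE.
  have -> : \sum_l S i l * A^T l j = \sum_(b <- s) coord Pi i b * (co j b : F).
    under eq_bigr => l _ do rewrite !mxE mulr_suml.
    rewrite exchange_big; apply: eq_bigr => b _ /=.
    have -> : (co j b : F) = \sum_l coord Pi l b * A^T l j.
      rewrite {1}(coord_basis Pi_basis (memvf b)) linear_sum.
      by apply: eq_bigr => l _; rewrite linearZ !mxE /= (tnth_nth 0 Pi l).
    by rewrite mulr_sumr; apply: eq_bigr => l _; rewrite !mxE mulrA.
  apply: (@mulIf _ 2); first by rewrite pnatr_eq0.
  rewrite mulr_natr sum_coord_coroot mulrnAl divfK ?pnatr_eq0 //.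
  by case: eqVneq => [->|].
have : S *m A^T \in unitmx.
  rewrite SA unitmxE det_diag unitfE; apply/prodf_neq0 => j _.
  by rewrite mxE mulf_neq0 ?invr_eq0 ?pnatr_eq0 // gt_eqF.
by rewrite unitmx_mul unitmx_tr => /andP[].
Qed.

Lemma cartan_inj (nu nu' : 'I_n -> nat) :
  (forall j, \sum_i cartan R Pi j i * (nu i)%:Z
     = \sum_i cartan R Pi j i * (nu' i)%:Z) -> nu = nu'.
Proof.
move=> e; set A := \matrix_(j < n, i < n) (co j (tnth Pi i) : F).
have Ae (f : 'I_n -> nat) : A *m \col_i (f i)%:R
    = \col_j (\sum_i cartan R Pi j i * (f i)%:Z)%:~R.
  apply/matrixP => j l; rewrite !mxE rmorph_sum; apply: eq_bigr => i _.
  by rewrite !mxE rmorphM /= cartanE.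
have : A *m \col_i (nu i)%:R = A *m \col_i (nu' i)%:R.
  by rewrite !Ae; apply/matrixP => j l; rewrite !mxE e.
move/(congr1 (mulmx (invmx A))); rewrite !mulKmx ?cartan_unit // => /matrixP E.
by apply/funext => i; have /eqP := E i ord0; rewrite !mxE eqr_nat => /eqP.
Qed.
End CartanMatrix.

(** * Irreducible quotients of Verma modules *)

Section IrreducibleIsHighestWeight.
Variables (n : nat) (a : 'I_n -> 'I_n -> int) (d : 'I_n -> nat) (k : fieldType).
Hypothesis d_gt0 : forall i, (0 < d i)%N.
Hypothesis a_diag : forall i, a i i = 2.
Local Notation UK := (UK a d (oner_neq0 k)).
Variables (L : lmodType UK) (lam : 'I_n -> int).
Hypothesis hL : irreducible_quotient (verma a d (oner_neq0 k) lam) L.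

(** At q = 1 the elements [k_i] commute with all generators and fix the highest
    weight vector. *)
Lemma torus_trivial (x : vspace_of L) :
  (forall i, opK i x = x) /\ (forall i, opKV i x = x).
Proof.
have [v [wv _ _ gen]] := highest_weight_vector hL; have [u ->] := gen x.
pose S (y : vspace_of L) :=
  (forall i, opK i y = y) /\ (forall i, opKV i y = y).
have KKV i (y : vspace_of L) : opK i (opKV i y) = y.
  rewrite -[RHS]act1 /opK /opKV -actM; congr (act _ y).
  by apply: val_inj; apply: qK_KV.
have KVK i (y : vspace_of L) : opKV i (opK i y) = y.
  rewrite -[RHS]act1 /opK /opKV -actM; congr (act _ y).
  by apply: val_inj; apply: qKV_K.
have KS y : (forall i, opK i y = y) -> S y.
  by move=> Ky; split=> // i; rewrite -{1}(Ky i) KVK.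
apply: (@stable_UK n a d k L S) => [|c y z [Ky _] [Kz _]|i b y [Ky _]
    |i b y [Ky _]|i y [Ky KVy]|i y [Ky KVy]|].
- by split=> i; rewrite linear0.
- by apply: KS => i; rewrite linearP /= Ky Kz.
- apply: KS => j; rewrite -{2}(Ky j).
  exact: (@act_qcomm _ _ _ _ _ j (divEZ a d i b) (KZ a d j) _ _ (qK_divE a d j i b)).
- apply: KS => j; rewrite -{2}(Ky j).
  exact: (@act_qcomm _ _ _ _ _ j (divFZ a d i b) (KZ a d j) _ _ (qK_divF a d j i b)).
- by rewrite Ky.
- by rewrite KVy.
by split=> i; [apply: wt_K wv | apply: wt_KV wv].
Qed.

Lemma irreducible_hw_module : exists v : vspace_of L,
  @hw_module n a k (spec_bin k d_gt0) (vspace_of L)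
    (fun i b => opE i b) (fun i b => opF i b)
    (fun i t => opB d_gt0 a_diag i 0 t) (@wt n a d k L) lam v.
Proof.
have [v [wv Ev v0 gen]] := highest_weight_vector hL; exists v.
split=> //.
- by move=> i x; apply: opE0.
- by move=> i x; apply: opF0.
- by move=> i j b c x; apply: opE_opF.
- by move=> m i b c x wx; apply: opE_opF_same.
- by move=> m; split=> [|c x y]; [apply: wt0 | apply: wt_sum_closed].
- by move=> m i b x wx; apply: wt_F.
- by move=> m i t x wx /=; rewrite -[m i]addr0; apply: wt_B.
move=> S [S0 Slin] SE SF [x Sx x0] y.
have SU (u : UK) z : S z -> S (u *: (z : L) : L).
  apply: stable_UK => // [i w|i w]; first by rewrite (torus_trivial w).1.
  by rewrite (torus_trivial w).2.
case: hL => [[_ simp] _]; pose P : {pred L} := fun z => `[<S z>].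
have Pcl : submod_closed P.
  split; first by apply/asboolP.
  move=> u z w /asboolP Sz /asboolP Sw; apply/asboolP.
  by apply: (stable_add Slin) Sw; apply: SU.
have [all0|all] := simp P Pcl; last exact/asboolP/all.
by move: x0; rewrite (all0 x) ?eqxx //; apply/asboolP.
Qed.
End IrreducibleIsHighestWeight.

Theorem theorem2
  (F : archiRealFieldType) (V : vectType F) (R : root_system V)
  (n : nat) (Pi : n.-tuple V) (hPi : is_root_basis R Pi)
  (d : 'I_n -> nat) (hd : is_symmetrizer R Pi d)
  (K : fieldType) (p : nat) (hp : p \in [pchar K])
  (lambda mu : V) (hlambda : is_weight R lambda) (hmu : is_weight R mu)
  (hle : weight_le Pi mu lambda)
  (r : nat) (hr : forall i : 'I_n, coord Pi i (lambda - mu) < (p ^ r)%:R)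
  (gamma : V) (hgamma : is_weight R gamma)
  (* q = 1 *)
  (L L' : lmodType (UK (cartan R Pi) d (oner_neq0 K)))
  (hL : irreducible_quotient
    (verma (cartan R Pi) d (oner_neq0 K) (pairing R Pi lambda)) L)
  (hL' : irreducible_quotient
    (verma (cartan R Pi) d (oner_neq0 K)
      (pairing R Pi (lambda + gamma *+ (p ^ r)))) L') :
  exists N : nat,
    has_dim (weight_space (M := L) (pairing R Pi mu)) N /\
    has_dim (weight_space (M := L') (pairing R Pi (mu + gamma *+ (p ^ r)))) N.
Proof.
have d_gt0 i : (0 < d i)%N.
  by case: hd => d123 _ _; have := d123 i; case: (d i).
have a_diag := cartan_diag hPi.
have [c cE] := hle.
have cN j : (c j < p ^ r)%N.
  have [_ Pi_basis _] := hPi; have := hr j.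
  rewrite cE linear_sum (bigD1 j) //= big1 => [|i ij].
    rewrite addr0 linearMn /= (tnth_nth 0) coord_free ?(basis_free Pi_basis) //.
    by rewrite eqxx mulr1n ltr_nat.
  rewrite linearMn /= (tnth_nth 0) coord_free ?(basis_free Pi_basis) //.
  by rewrite (negPf ij) mul0rn.
have pair_mu (la m : V) : is_weight R la -> is_weight R m ->
    la - m = \sum_i tnth Pi i *+ c i ->
    pairing R Pi m = lower (cartan R Pi) (pairing R Pi la) c.
  move=> wla wm E; apply/funext => j; apply: (@intr_inj F).
  rewrite /lower rmorphB /= !pairingE // rmorph_sum /=.
  rewrite (_ : m = la - (la - m)); last by rewrite opprB addrC subrK.
  rewrite E linearB /= linear_sum; congr (_ - _); apply: eq_bigr => i _.
  by rewrite linearMn /= rmorphM /= cartanE // mulr_natr.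
have w_shift la : is_weight R la -> is_weight R (la + gamma *+ (p ^ r)).
  move=> wla al ral; rewrite linearD linearMn /= rpredD ?wla //.
  by rewrite rpredMn // hgamma.
have [v hv] := irreducible_hw_module d_gt0 a_diag hL.
have [v' hv'] := irreducible_hw_module d_gt0 a_diag hL'.
have lamE j : pairing R Pi (lambda + gamma *+ (p ^ r)) j
    = pairing R Pi lambda j + pairing R Pi gamma j * (p ^ r)%:Z.
  apply: (@intr_inj F); rewrite rmorphD rmorphM /= !pairingE //; last first.
    exact: w_shift.
  by rewrite linearD linearMn mulr_natr.
have B_sep i m m' :
    (forall t, spec_bin K d_gt0 i m t = spec_bin K d_gt0 i m' t) -> m = m'.
  apply: (pascal_separates _ _ hp).
    by move=> x; apply: spec_bin0.
  by move=> x t; apply: spec_bin_pascal.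
have B_period i m u t : (t < p ^ r)%N ->
    spec_bin K d_gt0 i (m + u * (p ^ r)%:Z) t = spec_bin K d_gt0 i m t.
  apply: (pascal_periodicZ _ _ hp).
    by move=> x; apply: spec_bin0.
  by move=> x t'; apply: spec_bin_pascal.
have [N [b [b' [bP bP']]]] :=
  weight_spaces_same_dim B_sep (cartan_inj hPi) B_period hv hv' lamE cN.
exists N; split.
  by exists b; move: bP; rewrite -(pair_mu _ mu).
exists b'; move: bP'.
rewrite -(pair_mu _ (mu + gamma *+ p ^ r)) //; [exact: w_shift | exact: w_shift |].
by rewrite opprD addrACA subrr addr0.
Qed.
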